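(* Let $p\in(0,1)$, let $\mu$ be product measure with parameter $p$ on $\{0,1\}^{\mathbb{Z}^d}$, and let $\Gamma$ have law $\mu$. If $d\ge 3$, then there exists an extra head scheme $X$ for $\Gamma$ satisfying $$\mathbf{E}\exp(C\|X\|^d)<\infty$$ for some $C=C(d,p)>0$.
   Context: $\|\cdot\|$ is the Euclidean norm. Under product measure with parameter $p$ the coordinates $\Gamma(x)$, $x\in\mathbb{Z}^d$, are i.i.d. with $\mathbf{P}(\Gamma(x)=1)=p=1-\mathbf{P}(\Gamma(x)=0)$. For $z\in\mathbb{Z}^d$ and $\gamma\in\{0,1\}^{\mathbb{Z}^d}$, $(T^{-z}\gamma)(y)=\gamma(y+z)$. $\mu^*$ denotes the conditional law of $\Gamma$ given $\Gamma(0)=1$. An extra head scheme for $\Gamma$ is a $\mathbb{Z}^d$-valued random variable $X$ (on some joint probability space with $\Gamma$, possibly using additional randomness) such that $T^{-X}\Gamma$ has law $\mu^*$. *)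

(* Defs.v *)
From HB Require Import structures.
From mathcomp Require Import all_boot all_order all_algebra.
From mathcomp Require Import all_classical all_reals all_analysis.

Set Implicit Arguments.
Unset Strict Implicit.
Unset Printing Implicit Defensive.

Import Order.TTheory GRing.Theory Num.Theory.
Import numFieldNormedType.Exports.

Local Open Scope classical_set_scope.
Local Open Scope ring_scope.

Definition lattice (d : nat) : Type := 'rV[int]_d.

HB.instance Definition _ (d : nat) := GRing.Zmodule.on (lattice d).
HB.instance Definition _ (d : nat) := Countable.on (lattice d).
HB.instance Definition _ (d : nat) := isPointed.Build (lattice d) 0.
HB.instance Definition _ (d : nat) :=
  @isMeasurable.Build default_measure_display (lattice d) discrete_measurable
    discrete_measurable0 discrete_measurableC discrete_measurableU.

Definition enorm (R : realType) (d : nat) (z : lattice d) : R :=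
  Num.sqrt (\sum_(i < d) (z ord0 i)%:~R ^+ 2).

(* The product sigma-algebra on {0,1}^(Z^d) is the one generated by the
   coordinate maps. *)
Definition coordinate_events (d : nat) : set_system (lattice d -> bool) :=
  \bigcup_(x in [set: lattice d])
    preimage_set_system [set: lattice d -> bool] (fun g => g x) measurable.

Definition config (d : nat) := g_sigma_algebraType (@coordinate_events d).

(* [shiftN z g] is T^(-z) g. *)
Definition shiftN (d : nat) (z : lattice d) (g : config d) : config d :=
  fun y => g (y + z).

(* Agreement is required on measurable sets only: library measures also take
   (meaningless) values on non-measurable sets. *)
Definition has_law (dO dT : measure_display) (Omega : measurableType dO)
    (T : measurableType dT) (R : realType) (P : probability Omega R)
    (Y : Omega -> T) (nu : set T -> \bar R) : Prop :=
  forall A : set T, measurable A -> pushforward P Y A = nu A.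

(* Under mu, the coordinates are i.i.d. Bernoulli(p): mu is given by the product
   formula on every rectangle with finitely many constrained sites. *)
Definition is_product_measure (R : realType) (d : nat) (p : R)
    (mu : probability (config d) R) : Prop :=
  forall (s : seq (lattice d)) (B : lattice d -> set bool), uniq s ->
    mu [set g | forall x, x \in s -> B x (g x)]
      = (\prod_(x <- s) bernoulli_prob p (B x))%E.

Definition occupied_origin (d : nat) : set (config d) := [set g | g 0 = true].

(* mu^*, the conditional law given a head at the origin; it is only meaningful
   when [occupied_origin d] has positive mass. *)
Definition mustar (R : realType) (d : nat) (mu : probability (config d) R)
    (A : set (config d)) : \bar R :=
  (mu (A `&` @occupied_origin d) * ((fine (mu (@occupied_origin d)))^-1)%:E)%E.

(* Additional randomness is modelled by an enlargement of the probability space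
   carrying Gamma: a measure-preserving map [phi] from (Omega', P') to
   (Omega, P), along which Gamma is pulled back to [Gamma \o phi], and a random
   variable X defined on Omega'. *)
Definition extra_head_scheme (R : realType) (d : nat)
    (mu : probability (config d) R) (dO : measure_display)
    (Omega : measurableType dO) (P : probability Omega R)
    (Gamma : {RV P >-> config d}) (dO' : measure_display)
    (Omega' : measurableType dO') (P' : probability Omega' R)
    (phi : {RV P' >-> Omega}) (X : {RV P' >-> lattice d}) : Prop :=
  has_law P' phi P /\
  has_law P' (fun w => shiftN (X w) (Gamma (phi w))) (mustar mu).

(* Main.v *)
Require Import Defs.
From HB Require Import structures.
From mathcomp Require Import all_boot all_order all_algebra.
From mathcomp Require Import all_classical all_reals all_analysis.
From mathcomp Require Import measurable_realfun.
From mathcomp Require Import ring lra zify.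

Set Implicit Arguments.
Unset Strict Implicit.
Unset Printing Implicit Defensive.

Import Order.TTheory GRing.Theory Num.Theory.
Import numFieldNormedType.Exports.

Local Open Scope classical_set_scope.
Local Open Scope ring_scope.

(** Suppose that, given the configuration g, the shift X takes the value z with
probability k(g, z).  Because mu is invariant under shifts, the shifted
configuration has law mu^* exactly when m(x, y) = k(T^(-x) g, y - x) defines
a transport on Z^d in which almost surely every site sends out mass 1, every head
receives mass 1/p and the other sites receive nothing.  It is therefore enough
to transport mass inside large finite cubes, provided that the distances
travelled have a tail exp(-c r^d) uniformly in the size of the cube: viewing
the cube from a uniformly chosen source gives an approximate extra head scheme,
and these approximations have a limit.

Finite cubes.  The cube of side 2^n is halved along the coordinates in cyclic
order, down to single sites.  A second, continuous copy of the cube is cut at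
the same time, each box in proportion to the numbers of heads in the two halves
of the corresponding cell.  In the end every head owns a box whose volume
is the volume of the cube divided by the number of heads, every other site owns
a null set, and the boxes tile the cube (sum_box_overlap, prod_box_side).  The
mass sent from x to s is the volume that the unit cube at x shares with the box
of s.  Suppose that around s the number of heads in the cells of side 2^k is
correct up to a relative error of order (3/8)^(k-j), for all k >= j.  Then the
cuts at scale 2^k move the box by at most 2^k (3/8)^(k-j) = 2^j (3/4)^(k-j),
which sums to a multiple of 2^j, and since boxes are nested the smaller scales
add at most another multiple of 2^j (dyadic_drift, overlap_drift).  By a
Chernoff bound the supposition fails at scale 2^k with probability at most
exp(-c (9/64)^(k-j) 2^(kd)).  When d >= 3 one has (9/64) 2^d >= 9/8, so
these probabilities can be summed over k >= j, and the sum is of order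
exp(-c 2^(jd)) (tolerance_exponent, unbalanced_tail).  In lower dimensions the
large scales would dominate.  This gives a bound on the exponential
moment of the d-th power of the distance that does not depend on n
(transport_plans_exist).

The limit.  Each plan defines a joint law of the outcome and of X which is
dominated by P in the first coordinate, makes the shifted configuration
dominated by mu^*, and has total mass close to 1 (plan_content_fst,
plan_content_shift, plan_content_setT).  On each event X = z, a limit along an
ultrafilter is finitely additive and dominated by P, hence countably additive
(dominated_content_measure).  The exponential moment makes the laws of X
tight, so the limit has total mass 1 (limit_coupling), and two probabilities of
which one dominates the other are equal (law_of_le). *)

(** * Overlaps of an interval with the unit intervals *)

Section Overlap.
Variable R : realFieldType.
Implicit Types t a b c x y : R.

Definition clamp N x : R := Num.min (Num.max x 0) N.

Notation clamp01 := (clamp 1).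

(** The length of the intersection of [a, b] and [t, t + 1]. Written as a
difference, it is additive under cutting without any case distinction. *)
Definition overlap t a b : R := clamp01 (b - t) - clamp01 (a - t).

Lemma clampP N x : 0 <= N -> [\/ x <= 0 /\ clamp N x = 0,
  0 <= x <= N /\ clamp N x = x | N <= x /\ clamp N x = N].
Proof.
rewrite /clamp => N0; case: (leP x 0) => x0.
  by apply: Or31; split=> //; rewrite min_l.
case: (leP x N) => x1; first by apply: Or32; rewrite (ltW x0).
by apply: Or33; rewrite (ltW x1).
Qed.

Let clamp01P x := @clampP 1 x ler01.

Lemma le_clamp01 x y : x <= y -> clamp01 x <= clamp01 y.
Proof.
by move=> xy; case: (clamp01P x) => -[x1 ->]; case: (clamp01P y) => -[y1 ->]; lra.
Qed.

Lemma overlap_ge0 t a b : a <= b -> 0 <= overlap t a b.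
Proof. by move=> ab; rewrite subr_ge0 le_clamp01 ?lerB. Qed.

Lemma overlap_cat t a b c : overlap t a b + overlap t b c = overlap t a c.
Proof. by rewrite /overlap; ring. Qed.

Lemma overlap_neq0 t a b : a <= b -> overlap t a b != 0 -> a < t + 1 /\ t < b.
Proof.
move=> ab /eqP; rewrite /overlap.
case: (clamp01P (a - t)) => -[x1 ->]; case: (clamp01P (b - t)) => -[y1 ->];
  move=> h; split; try lra; exfalso; apply: h; lra.
Qed.

Lemma overlap_full t N : 0 <= t -> t + 1 <= N -> overlap t 0 N = 1.
Proof.
move=> t0 tN; rewrite /overlap.
by case: (clamp01P (0 - t)) => -[x1 ->]; case: (clamp01P (N - t)) => -[y1 ->]; lra.
Qed.

Lemma sum_clamp01 N x : \sum_(t < N) clamp01 (x - t%:R) = clamp N%:R x.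
Proof.
elim: N => [|N IH].
  by rewrite big_ord0 /clamp min_r // le_max lexx orbT.
rewrite big_ord_recr /= {}IH.
have N0 : 0 <= N%:R :> R by [].
have N1 : N.+1%:R = N%:R + 1 :> R by rewrite -natr1.
have N10 : 0 <= N.+1%:R :> R by [].
case: (clamp01P (x - N%:R)) => -[h ->]; case: (clampP x N0) => -[h1 ->];
  case: (clampP x N10) => -[h2 ->]; lra.
Qed.

Lemma sum_overlap_le N a b :
  a <= b -> \sum_(t < N) overlap t%:R a b <= b - a.
Proof.
move=> ab; rewrite sumrB !sum_clamp01.
have N0 : 0 <= N%:R :> R by [].
by case: (clampP a N0) => -[h1 ->]; case: (clampP b N0) => -[h2 ->]; lra.
Qed.

End Overlap.

(** * One coordinate: proportional cutting against dyadic cutting *)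

Section DyadicAddress.
Variables (n : nat) (b : nat -> bool).

(** The left end of the dyadic interval of side 2^k that contains the number
with binary digits b. *)
Definition addr k : nat := (\sum_(k <= i < n) b i * 2 ^ i)%N.

Lemma addr_rec k : (k < n)%N -> addr k = (b k * 2 ^ k + addr k.+1)%N.
Proof. by move=> kn; rewrite /addr big_ltn. Qed.

Lemma addr_end : addr n = 0%N.
Proof. by rewrite /addr big_geq. Qed.

Lemma addr_bounds j : (j <= n)%N -> (addr j <= addr 0 < addr j + 2 ^ j)%N.
Proof.
elim: j => [|j IH] jn; first by rewrite leqnn expn0 addn1 leqnn.
have /andP[h1 h2] := IH (ltnW jn); move: h1 h2; rewrite (addr_rec jn) expnS.
by case: (b j); lia.
Qed.

End DyadicAddress.

Lemma addr_inj n (b b' : nat -> bool) :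
  addr n b 0 = addr n b' 0 -> forall k, (k < n)%N -> b k = b' k.
Proof.
have E c : addr n c 0 = (\sum_(0 <= i < n) c i * 2 ^ i)%N by [].
rewrite !E {E}; elim: n b b' => [//|n IH] b b'.
rewrite !(big_nat_recl n 0) //= => h.
have S (c : nat -> bool) : (\sum_(0 <= i < n) c i.+1 * 2 ^ i.+1)%N =
    (2 * \sum_(0 <= i < n) c i.+1 * 2 ^ i)%N.
  by rewrite big_distrr /=; apply: eq_bigr => i _; rewrite expnS mulnCA.
move: h; rewrite !(S b) !(S b') !expn0 !muln1 => h.
have [h0 h1] : b 0%N = b' 0%N /\ (\sum_(0 <= i < n) b i.+1 * 2 ^ i =
    \sum_(0 <= i < n) b' i.+1 * 2 ^ i)%N.
  move: h; case: (b 0%N); case: (b' 0%N) => h; split=> //; lia.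
by case=> [//|k kn]; apply: (IH (fun i => b i.+1) (fun i => b' i.+1)).
Qed.

(** Here P is half the ideal side, S the actual side, Q the error allowed at
this scale, and rho the fraction kept. The error inherited from the previous
scale is (3/8) P Q and the new one is at most (11/32) P Q, so the total stays
below P Q: the errors can shrink by the factor 3/8 from a scale to the next
larger one. *)
Lemma half_error (R : realFieldType) (rho S P Q : R) :
  0 < P -> 0 < Q -> Q <= 1 -> `|rho - 1 / 2| <= 1 / 8 * Q ->
  `|S - 2 * P| <= 3 / 4 * (P * Q) -> `|rho * S - P| <= P * Q.
Proof.
move=> P0 Q0 Q1 hrho hS.
have PQ0 : 0 < P * Q by rewrite mulr_gt0.
have PQP : P * Q <= P by rewrite -[leRHS]mulr1 ler_pM2l.
have SP : `|S| <= 11 / 4 * P by move: hS; rewrite !ler_norml; lra.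
have h : `|(rho - 1 / 2) * S| <= 1 / 8 * Q * (11 / 4 * P) by rewrite normrM ler_pM.
have -> : rho * S - P = (rho - 1 / 2) * S + (S - 2 * P) / 2 by field.
have {}h : `|(rho - 1 / 2) * S| <= 11 / 32 * (P * Q).
  by apply: le_trans h _; rewrite le_eqVlt; apply/orP; left; apply/eqP; field.
move: h hS; move: (_ * S) (S - _) (P * Q) PQ0 => x y z z0.
by rewrite !ler_norml; lra.
Qed.

Section NestedIntervals.
Variables (R : realFieldType) (n : nat) (b : nat -> bool) (r : nat -> R).

(** The interval obtained from [0, 2^n] by the cuts at the scales n - 1, ...,
k, where r i is the fraction kept at scale i: the left part if the digit b i
is 0, the right part if it is 1. With r = 1/2 it would be the dyadic interval
that starts at addr n b k. *)
Definition side k : R := 2 ^+ n * \prod_(k <= i < n) r i.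

Definition left_end k : R :=
  \sum_(k <= i < n) (if b i then (1 - r i) * side i.+1 else 0).

Lemma side_rec k : (k < n)%N -> side k = r k * side k.+1.
Proof. by move=> kn; rewrite /side big_ltn // mulrCA. Qed.

Lemma side_end : side n = 2 ^+ n.
Proof. by rewrite /side big_geq // mulr1. Qed.

Lemma left_end_rec k : (k < n)%N ->
  left_end k = left_end k.+1 + (if b k then (1 - r k) * side k.+1 else 0).
Proof. by move=> kn; rewrite /left_end big_ltn // addrC. Qed.

Lemma left_end_end : left_end n = 0.
Proof. by rewrite /left_end big_geq. Qed.

Hypothesis r01 : forall k, 0 <= r k <= 1.

Lemma side_ge0 k : 0 <= side k.
Proof.
by rewrite mulr_ge0 ?exprn_ge0 // prodr_ge0 // => i _; case/andP: (r01 i).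
Qed.

Lemma nested_intervals j : (j <= n)%N ->
  left_end j <= left_end 0 /\ left_end 0 + side 0 <= left_end j + side j.
Proof.
elim: j => [|j IH] jn; first by [].
have [h1 h2] := IH (ltnW jn); move: h1 h2.
rewrite (left_end_rec jn) (side_rec jn); have S0 := side_ge0 j.+1.
have /andP[r0 r1] := r01 j.
have rS : 0 <= r j * side j.+1 by rewrite mulr_ge0.
have rS1 : 0 <= (1 - r j) * side j.+1 by rewrite mulr_ge0 // subr_ge0.
by case: (b j); split; lra.
Qed.

Variable j : nat.
Hypothesis jn : (j <= n)%N.
Hypothesis r_half : forall k, (j <= k < n)%N ->
  `|r k - 1 / 2| <= 1 / 8 * (3 / 8) ^+ (k - j).

(** The displacement created at scale 2^k is at most 2^k (3/8)^(k-j) = 2^j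
(3/4)^(k-j), a geometric sequence in k; its tail from k on is the bound for
the left end. *)
Lemma dyadic_drift k : (j <= k <= n)%N ->
  `|side k - 2 ^+ k| <= 2 ^+ k * (3 / 8) ^+ (k - j) /\
  `|left_end k - (addr n b k)%:R| <= 4 * (2 ^+ j * (3 / 4) ^+ (k - j)).
Proof.
move=> /andP[jk kn]; have [m Em] : exists m, (k + m)%N = n.
  by exists (n - k)%N; lia.
elim: m k Em jk kn => [|m IH] k Em jk kn.
  have -> : k = n by lia.
  rewrite side_end left_end_end addr_end !subrr normr0.
  by split; rewrite !mulr_ge0 ?exprn_ge0 // ?divr_ge0.
have nk : (k < n)%N by lia.
have Em1 : (k.+1 + m)%N = n by lia.
have jk1 : (j <= k.+1)%N by lia.
have [] := IH k.+1 Em1 jk1 nk.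
rewrite (side_rec nk) (left_end_rec nk) (addr_rec b nk) subSn // !exprS.
set S := side _; set P := 2 ^+ k; set Q := (3 / 8) ^+ _; set T := (3 / 4) ^+ _.
set l := left_end _; set a := addr n b k.+1; set J := 2 ^+ j => hS hl.
have P0 : 0 < P by rewrite exprn_gt0.
have Q0 : 0 < Q by apply: exprn_gt0; lra.
have Q1 : Q <= 1 by apply: exprn_ile1; lra.
(* the bounds for the side and for the left end in the same unit *)
have PQ : P * Q = J * T.
  rewrite /P /Q /J /T -{1}(subnKC jk) exprD -mulrA -exprMn.
  by have -> : 2 * (3 / 8) = 3 / 4 :> R by field.
have PQ0 : 0 < P * Q by rewrite mulr_gt0.
have rh := @r_half k; rewrite jk nk in rh; have {}rh := rh isT.
rewrite -/Q in rh.
have hS' : `|S - 2 * P| <= 3 / 4 * (P * Q).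
  by apply: le_trans hS _; rewrite le_eqVlt; apply/orP; left; apply/eqP; field.
have rS : `|r k * S - P| <= P * Q by apply: half_error.
have r1S : `|(1 - r k) * S - P| <= P * Q.
  apply: half_error => //; rewrite distrC.
  by have -> : 1 / 2 - (1 - r k) = r k - 1 / 2 by field.
split=> //.
have hl' : `|l - a%:R| <= 3 * (P * Q).
  by apply: le_trans hl _; rewrite PQ le_eqVlt; apply/orP; left; apply/eqP; field.
case: (b k); rewrite ?mul0n ?mul1n ?add0n ?addr0; last by rewrite -PQ; lra.
rewrite natrD natrX -/P -PQ.
have -> : l + (1 - r k) * S - (P + a%:R) = (l - a%:R) + ((1 - r k) * S - P) by ring.
by apply: le_trans (ler_normD _ _) _; lra.
Qed.

(** Nothing is assumed about the fractions below scale j. The final interval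
is still inside the one of scale j, which has length at most 2 * 2^j and
starts within 4 * 2^j of the dyadic interval containing the number itself. *)
Lemma overlap_drift t :
  overlap t (left_end 0) (left_end 0 + side 0) != 0 ->
  `|(addr n b 0)%:R - t| <= 6 * 2 ^+ j.
Proof.
move=> /overlap_neq0 []; first by rewrite lerDl side_ge0.
have [h1 h2] := nested_intervals jn.
have [] := @dyadic_drift j; first by rewrite leqnn jn.
rewrite subnn !expr0 !mulr1 !ler_norml => /andP[h3 h4] /andP[h5 h6] h7 h8.
have /andP[] := addr_bounds b jn.
rewrite -(ler_nat R) -(ltr_nat R) natrD natrX => h9 h10.
have J1 : 1 <= 2 ^+ j :> R by rewrite exprn_ege1 // ler1n.
by lra.
Qed.

End NestedIntervals.

(** * Cells, fractions of heads and boxes *)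

Section Sites.
Variable L : nat.

(** In dimension d the digit of weight 2^k of coordinate i is stored at index
k * d + i. Cutting a cube in two along the coordinates in cyclic order then
amounts to fixing the digits one by one, from the highest index down. *)
Definition site := {ffun 'I_L -> bool}.
Implicit Types s : site.

Definition bit s v : bool := oapp s false (insub v).

Definition flip u s : site := [ffun v => s v (+) (val v == u)].

(** The sites that agree with s from index u on form the cell of s after all
cuts of index at least u; for u <= L it
has 2^u elements. *)
Definition agree u s s' := [forall v : 'I_L, (u <= v)%N ==> (s v == s' v)].

Lemma bit_ord s (v : 'I_L) : bit s v = s v.
Proof. by rewrite /bit valK. Qed.

Lemma bit_flip u s v : (u < L)%N -> bit (flip u s) v = bit s v (+) (v == u).
Proof.
move=> uL; rewrite /bit; case: insubP => [v' _ <- /=|]; first by rewrite ffunE.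
by case: eqP => [->|_ _ //]; rewrite uL.
Qed.

Lemma flipK u : involutive (flip u).
Proof. by move=> s; apply/ffunP => v; rewrite !ffunE addbK. Qed.

Lemma agreeP u s s' :
  reflect (forall v, (u <= v)%N -> bit s v = bit s' v) (agree u s s').
Proof.
apply: (iffP forallP) => h v.
  move=> uv; rewrite /bit; case: insubP => //= v' _ E.
  by have /implyP := h v'; rewrite E uv => /(_ isT) /eqP.
by apply/implyP => uv; rewrite -!bit_ord h.
Qed.

Lemma agree_eqr u s s' : agree u s s' -> agree u s =1 agree u s'.
Proof.
move=> /agreeP h s''; apply/agreeP/agreeP => h' v uv; last by rewrite h ?h'.
by rewrite -h ?h'.
Qed.

Lemma agreeW u v s s' : (u <= v)%N -> agree u s s' -> agree v s s'.
Proof. by move=> uv /agreeP h; apply/agreeP => w vw; rewrite h //; lia. Qed.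

Lemma agree_flip u s : (u < L)%N -> agree u.+1 s (flip u s).
Proof.
move=> uL; apply/agreeP => v uv.
by rewrite bit_flip //; case: eqP => [?|]; [lia|rewrite addbF].
Qed.

Lemma agree_split u s s' : (u < L)%N ->
  agree u s s' = agree u.+1 s s' && (bit s' u == bit s u).
Proof.
move=> uL; apply/idP/andP => [h|[/agreeP h /eqP h0]].
  by split; [exact: agreeW h | have /agreeP -> := h].
by apply/agreeP => v; rewrite leq_eqVlt => /orP[/eqP <- //|]; apply: h.
Qed.

Section CellSum.
Variables (R : nmodType) (f : site -> R).

Definition cell_sum u s : R := \sum_(s' | agree u s s') f s'.

Lemma cell_sum_agree u s s' : agree u s s' -> cell_sum u s = cell_sum u s'.
Proof. by move=> h; apply: eq_bigl; apply: agree_eqr. Qed.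

Lemma cell_sum_split u s : (u < L)%N ->
  cell_sum u.+1 s = cell_sum u s + cell_sum u (flip u s).
Proof.
move=> uL; rewrite /cell_sum (bigID (fun s' => bit s' u == bit s u)) /=.
congr (_ + _); apply: eq_bigl => s'; first by rewrite [RHS]agree_split.
rewrite [RHS]agree_split // bit_flip // eqxx addbT -(agree_eqr (agree_flip s uL)).
by case: (bit s' u); case: (bit s u).
Qed.

Lemma cell_sum0 s : cell_sum 0 s = f s.
Proof.
rewrite /cell_sum (big_pred1 s) // => s'; apply/agreeP/eqP => [h|->//].
by apply/ffunP => v; rewrite -!bit_ord h.
Qed.

Lemma cell_sumL s : cell_sum L s = \sum_s' f s'.
Proof.
apply: eq_bigl => s'; apply/agreeP => v Lv.
by rewrite /bit insubF //; apply/negbTE; rewrite -leqNgt.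
Qed.

End CellSum.

Lemma cell_card (R : pzSemiRingType) u s : (u <= L)%N ->
  cell_sum (fun=> 1 : R) u s = 2 ^+ u.
Proof.
elim: u s => [|u IH] s uL; first by rewrite cell_sum0.
by rewrite cell_sum_split // !IH ?(ltnW uL) // exprS mulr_natl.
Qed.

Lemma card_site : #|{: site}| = (2 ^ L)%N.
Proof. by rewrite card_ffun card_bool card_ord. Qed.

Section Fractions.
Variables (R : realFieldType) (eta : site -> bool).

Definition heads u s : R := cell_sum (fun s' => (eta s')%:R) u s.

(** The value 1/2 in an empty cell keeps two identities true without
exception: the fractions of the two halves add up to 1, and a fraction times
the number of heads of the cell is the number of heads of the half. *)
Definition frac u s : R :=
  if heads u.+1 s == 0 then 1 / 2 else heads u s / heads u.+1 s.

Lemma heads_ge0 u s : 0 <= heads u s.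
Proof. exact: sumr_ge0. Qed.

Lemma le_heads u s : heads u s <= heads u.+1 s.
Proof.
rewrite /heads /cell_sum [leRHS](bigID (agree u s)) /=.
rewrite [X in _ <= X + _](eq_bigl (agree u s)) ?lerDl ?sumr_ge0 // => s'.
by apply: andb_idl; apply: agreeW.
Qed.

Lemma frac01 u s : 0 <= frac u s <= 1.
Proof.
rewrite /frac; case: eqP => [_|/eqP h]; first lra.
have H0 : 0 < heads u.+1 s by rewrite lt_neqAle eq_sym h heads_ge0.
by rewrite divr_ge0 ?heads_ge0 //= ler_pdivrMr // mul1r le_heads.
Qed.

Lemma frac_heads u s : frac u s * heads u.+1 s = heads u s.
Proof.
rewrite /frac; case: eqP => [h|/eqP h]; last by rewrite divfK.
apply/le_anti; rewrite h mulr0 heads_ge0 /=.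
by have := le_heads u s; rewrite h.
Qed.

Lemma frac_agree u s s' : agree u s s' -> frac u s = frac u s'.
Proof.
move=> h; rewrite /frac /heads (cell_sum_agree _ h).
by rewrite (cell_sum_agree _ (agreeW (leqnSn u) h)).
Qed.

Lemma frac_flip u s : (u < L)%N -> frac u (flip u s) = 1 - frac u s.
Proof.
move=> uL; rewrite /frac /heads -(cell_sum_agree _ (agree_flip s uL)).
case: eqP => [_|/eqP]; first by field.
rewrite (cell_sum_split _ s uL).
move: (cell_sum _ u s) (cell_sum _ u (flip u s)) => x y h.
by field.
Qed.

(** The difference of the two counts is at most 2 * delta * m and their sum is
at least m. *)
Lemma frac_half (m delta : R) u s : (u < L)%N -> 0 < m -> 0 <= delta <= 1 / 2 ->
  `|heads u s - m| <= delta * m -> `|heads u (flip u s) - m| <= delta * m ->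
  `|frac u s - 1 / 2| <= delta.
Proof.
move=> uL m0 /andP[d0 d1]; rewrite /frac.
rewrite /heads (cell_sum_split _ s uL) -!/(heads _ _).
move: (heads u s) (heads u (flip u s)) => x y hx hy.
have dm : delta * m <= 1 / 2 * m by rewrite ler_pM2r.
have dm0 : 0 <= delta * m by rewrite mulr_ge0 // ltW.
have xy0 : m <= x + y by move: hx hy; rewrite !ler_norml; lra.
have xyp : 0 < x + y by exact: lt_le_trans xy0.
rewrite gt_eqF //.
have -> : x / (x + y) - 1 / 2 = (x - y) / 2 / (x + y) by field; rewrite gt_eqF.
rewrite normrM normfV (gtr0_norm xyp) ler_pdivrMr //.
have : `|(x - y) / 2| <= delta * m by move: hx hy; rewrite !ler_norml; lra.
by move/le_trans; apply; rewrite ler_wpM2l.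
Qed.

End Fractions.
End Sites.

Section Boxes.
Variables (R : realFieldType) (n d : nat).
Local Notation L := (n * d)%N.
Local Notation site := (site L).
Variable eta : site -> bool.
Implicit Types s : site.

Definition coord_bit s i k := bit s (k * d + i).
Definition coord_frac s i k : R := frac R eta (k * d + i) s.

Definition pos_coord s i : nat := addr n (coord_bit s i) 0.

Definition box_side s i k := side n (coord_frac s i) k.
Definition box_left s i k := left_end n (coord_bit s i) (coord_frac s i) k.

Definition box_overlap s i k t :=
  overlap t (box_left s i k) (box_left s i k + box_side s i k).

Lemma digit_lt k i : (k < n)%N -> (i < d)%N -> (k * d + i < L)%N.
Proof.
by move=> kn id; have := leq_mul kn (leqnn d); rewrite mulSn; lia.
Qed.

Lemma digit_le k k' i : (k <= k')%N -> (k * d + i <= k' * d + i)%N.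
Proof. by move=> kk'; rewrite leq_add2r leq_mul2r kk' orbT. Qed.

Lemma box_side_ge0 s i k : 0 <= box_side s i k.
Proof. by apply: side_ge0 => k'; apply: frac01. Qed.

Lemma box_side_agree u s s' i k : agree u s s' -> (u <= k * d + i)%N ->
  box_side s i k = box_side s' i k.
Proof.
move=> h uk; rewrite /box_side /side; congr (_ * _).
apply: eq_big_nat => k' /andP[kk' _]; apply: frac_agree.
exact: agreeW (leq_trans uk (digit_le _ kk')) h.
Qed.

Lemma box_left_agree u s s' i k : agree u s s' -> (u <= k * d + i)%N ->
  box_left s i k = box_left s' i k.
Proof.
move=> h uk; apply: eq_big_nat => k' /andP[kk' _].
have uk' := leq_trans uk (digit_le i kk').
rewrite /coord_bit (agreeP _ _ _ h) //; case: ifP => // _.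
rewrite -!/(box_side _ _ _) (box_side_agree h); last first.
  exact: leq_trans uk (digit_le i (leqW kk')).
by rewrite /coord_frac (frac_agree _ _ (agreeW uk' h)).
Qed.

Lemma box_overlap_agree u s s' i k t : agree u s s' -> (u <= k * d + i)%N ->
  box_overlap s i k t = box_overlap s' i k t.
Proof.
by move=> h uk; rewrite /box_overlap (box_side_agree h) // (box_left_agree h).
Qed.

Lemma box_side_rec s i k : (k < n)%N ->
  box_side s i k = coord_frac s i k * box_side s i k.+1.
Proof. exact: side_rec. Qed.

Lemma box_left_rec s i k : (k < n)%N ->
  box_left s i k = box_left s i k.+1 +
    (if coord_bit s i k then (1 - coord_frac s i k) * box_side s i k.+1 else 0).
Proof. exact: left_end_rec. Qed.

Lemma box_overlap_split s i k t : (k < n)%N -> (i < d)%N ->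
  box_overlap s i k t + box_overlap (flip (k * d + i) s) i k t =
  box_overlap s i k.+1 t.
Proof.
move=> kn id; set u := (k * d + i)%N; have uL := digit_lt kn id.
rewrite /box_overlap !(box_left_rec _ _ kn) !(box_side_rec _ _ kn).
have ag := agree_flip s uL.
have uk : (u.+1 <= k.+1 * d + i)%N by rewrite /u mulSn; lia.
rewrite -(box_side_agree ag uk) -(box_left_agree ag uk).
rewrite /coord_bit /coord_frac -/u bit_flip // eqxx addbT frac_flip //.
set l := box_left _ _ _; set S := box_side _ _ _; set r := frac _ _ _ _.
have E : l + (1 - r) * S + r * S = l + S by ring.
case: (bit s u) => /=; rewrite addr0.
  by rewrite E addrC overlap_cat.
by rewrite subKr (addrAC l) E overlap_cat.
Qed.

(** In the middle of level k, after the cut of index k * d + c, the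
coordinates below c have been cut only down to side 2^(k+1). *)
Definition level c k i : nat := if (i < c)%N then k.+1 else k.

(** Induction along the order of the cuts, from the whole cube (level n) to
the single sites (level 0). *)
Lemma descending_cuts (P : nat -> nat -> Prop) : P n 0%N ->
  (forall k, (k < n)%N -> P k.+1 0%N -> P k d) ->
  (forall k c, (k < n)%N -> (c < d)%N -> P k c.+1 -> P k c) -> P 0%N 0%N.
Proof.
move=> Pn Pd Pc.
suff H m : forall k, (k + m)%N = n -> P k 0%N by apply: (H n).
elim: m => [|m IH] k kmn; first by have -> : k = n by lia.
have kn : (k < n)%N by lia.
have Pk := Pd k kn (IH k.+1 ltac:(lia)).
suff H c' : forall c, (c + c')%N = d -> P k c by apply: (H d).
elim: c' => [|c' IH'] c cd; first by have -> : c = d by lia.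
by apply: Pc => //; [lia|apply: IH'; lia].
Qed.

Lemma prod_level_step (V : comPzRingType) (f : 'I_d -> nat -> V) k (c : 'I_d) :
  \prod_(i < d) f i (level c k i) =
    f c k * \prod_(i < d | i != c) f i (level c k i) /\
  \prod_(i < d) f i (level c.+1 k i) =
    f c k.+1 * \prod_(i < d | i != c) f i (level c k i).
Proof.
split; rewrite (bigD1 c) //= /level ?ltnn ?ltnSn //; congr (_ * _).
apply: eq_bigr => i; rewrite -val_eqE /= => ic.
by rewrite ltnS leq_eqVlt (negbTE ic).
Qed.

(** The two halves of a cell differ by one flipped digit, and their boxes tile
the box of the cell. Summed over all sites, the overlap of a cell of index u
is counted 2^u times, hence the invariant of the induction. *)
Lemma sum_box_overlap (t : 'I_d -> R) :
  (forall i, 0 <= t i /\ t i + 1 <= 2 ^+ n) ->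
  \sum_s \prod_(i < d) box_overlap s i 0 (t i) = 1.
Proof.
move=> tn; pose F k c s := \prod_(i < d) box_overlap s i (level c k i) (t i).
suff : \sum_s F 0%N 0%N s = 2 ^+ (0 * d + 0) by rewrite mul0n.
apply: (@descending_cuts (fun k c => \sum_s F k c s = 2 ^+ (k * d + c))).
- rewrite (eq_bigr (fun=> 1)) => [|s _].
    by rewrite sumr_const card_site addn0 natrX.
  apply: big1 => i _; rewrite /level ltn0 /box_overlap /box_left /box_side.
  rewrite left_end_end side_end add0r.
  by have [t0 t1] := tn i; exact: overlap_full.
- move=> k kn; rewrite mulSn addn0 addnC => <-; apply: eq_bigr => s _.
  by apply: eq_bigr => i _; rewrite /level ltn_ord ltn0.
move=> k c kn cd /=; rewrite addnS exprS => E.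
have two0 : (2 : R) != 0 by rewrite pnatr_eq0.
apply: (mulfI two0); rewrite -{}E mulr_natl mulr2n.
(* of the two copies of the sum over the sites, flip the digit in one *)
rewrite {2}(reindex_inj (inv_inj (@flipK _ (k * d + c)))) -big_split /=.
apply: eq_bigr => s _; pose c' := Ordinal cd; rewrite /F.
have [_ ->] := prod_level_step (fun i k' => box_overlap s i k' (t i)) k c'.
have [-> _] := prod_level_step (fun i k' => box_overlap s i k' (t i)) k c'.
set s' := flip _ s.
have [-> _] := prod_level_step (fun i k' => box_overlap s' i k' (t i)) k c'.
rewrite -box_overlap_split // [RHS]mulrDl; congr (_ + _ * _).
apply: eq_bigr => i ic; apply/esym/box_overlap_agree.
  exact/agree_flip/digit_lt.
move: ic; rewrite -val_eqE /= /level => ic; case: (ltnP i c) => h.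
  by rewrite mulSn; have := ltn_ord i; lia.
by move: h; rewrite leq_eqVlt eq_sym (negbTE ic) /=; lia.
Qed.

(** The volume is multiplied by a fraction of heads at each cut, and these
fractions telescope. *)
Lemma prod_box_side s :
  \prod_(i < d) box_side s i 0 * heads R eta L s = 2 ^+ L * (eta s)%:R.
Proof.
pose V k c := \prod_(i < d) box_side s i (level c k i).
suff : V 0%N 0%N * heads R eta L s = 2 ^+ L * heads R eta (0 * d + 0) s.
  by rewrite mul0n /heads cell_sum0.
apply: (@descending_cuts (fun k c =>
  V k c * heads R eta L s = 2 ^+ L * heads R eta (k * d + c) s)).
- rewrite addn0; congr (_ * _); rewrite /V (eq_bigr (fun=> 2 ^+ n)).
    by rewrite prodr_const card_ord exprM.
  by move=> i _; rewrite /level ltn0 /box_side side_end.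
- move=> k kn; rewrite mulSn addn0 addnC => <-; congr (_ * _).
  by apply: eq_bigr => i _; rewrite /level ltn_ord ltn0.
move=> k c kn cd; pose c' := Ordinal cd.
rewrite -(frac_heads R eta (k * d + c)) mulrCA addnS => <-.
rewrite mulrA; congr (_ * _).
rewrite /V; have [-> ->] := prod_level_step (fun i k' => box_side s i k') k c'.
by rewrite (box_side_rec _ _ kn) -mulrA.
Qed.

Lemma box_overlap_local s j (t : 'I_d -> R) : (j <= n)%N ->
  (forall u, (j * d <= u < L)%N ->
    `|frac R eta u s - 1 / 2| <= 1 / 8 * (3 / 8) ^+ (u %/ d - j)) ->
  \prod_(i < d) box_overlap s i 0 (t i) != 0 ->
  forall i : 'I_d, `|(pos_coord s i)%:R - t i| <= 6 * 2 ^+ j.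
Proof.
move=> jn good /prodf_neq0 ov i; apply: overlap_drift jn _ _ (ov i isT).
  by move=> k; apply: frac01.
move=> k /andP[jk kn].
have hu : (j * d <= k * d + i < L)%N.
  by rewrite digit_lt // andbT (leq_trans _ (leq_addr _ _)) // leq_mul2r jk orbT.
have := good _ hu.
by rewrite divnMDl ?(leq_ltn_trans _ (ltn_ord i)) // divn_small // addn0.
Qed.

End Boxes.

(** * Chernoff bound for product Bernoulli weights *)

Section Weights.
Variables (R : realType) (p : R) (S : finType).
Hypothesis p01 : 0 < p < 1.
Implicit Types (eta : {ffun S -> bool}) (D : pred S).

Definition weight eta : R := \prod_s (if eta s then p else 1 - p).

Lemma weight_ge0 eta : 0 <= weight eta.
Proof.
by have /andP[p0 p1] := p01; apply: prodr_ge0 => s _; case: (eta s); lra.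
Qed.

Lemma sum_weight_prod (f : S -> bool -> R) :
  \sum_eta weight eta * \prod_s f s (eta s) =
  \prod_s (p * f s true + (1 - p) * f s false).
Proof.
pose F s b := (if b then p else 1 - p) * f s b.
rewrite (eq_bigr (fun eta : {ffun S -> bool} => \prod_s F s (eta s))); last first.
  by move=> eta _; rewrite /weight -big_split.
rewrite -(bigA_distr_bigA F) /=.
by apply: eq_bigr => s _; rewrite big_bool.
Qed.

Lemma sum_weight : \sum_eta weight eta = 1.
Proof.
rewrite (eq_bigr (fun eta => weight eta * \prod_(s : S) 1)) => [|eta _].
  rewrite (sum_weight_prod (fun _ _ => 1)).
  by apply: big1 => s _; rewrite !mulr1 addrC subrK.
by rewrite big1_eq mulr1.
Qed.

(** From exp(-x) >= 1 - x and (1 + x + 2x^2)(1 - x) = 1 + x^2 (1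
- 2x) >= 1. *)
Lemma expR_le_quadratic (x : R) : x <= 1 / 2 -> expR x <= 1 + x + 2 * x ^+ 2.
Proof.
move=> x12.
have := expR_ge1Dx (- x); rewrite expRN => h.
have e0 := expR_gt0 x.
have x2 : 0 <= x ^+ 2 by rewrite sqr_ge0.
have h1 : 0 < 1 - x by lra.
have h2 : expR x * (1 - x) <= 1.
  by have := ler_wpM2l (ltW e0) h; rewrite mulfV // gt_eqF.
rewrite -(ler_pM2r h1); apply: le_trans h2 _.
have -> : (1 + x + 2 * x ^+ 2) * (1 - x) = 1 + x ^+ 2 * (1 - 2 * x) by ring.
by rewrite lerDl mulr_ge0 //; lra.
Qed.

(** The linear terms cancel because the variable is centred. *)
Lemma bernoulli_mgf (lambda : R) : `|lambda| <= 1 / 2 ->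
  p * expR (lambda * (1 - p)) + (1 - p) * expR (lambda * (0 - p))
    <= expR (2 * lambda ^+ 2).
Proof.
rewrite ler_norml => /andP[l1 l2]; have /andP[p0 p1] := p01.
have h1 : lambda * (1 - p) <= 1 / 2 by nra.
have h2 : lambda * (0 - p) <= 1 / 2 by nra.
have := expR_le_quadratic h1; have := expR_le_quadratic h2.
set a := expR _; set b := expR _ => ha hb.
apply: le_trans (expR_ge1Dx _).
have ha' : (1 - p) * a <=
    (1 - p) * (1 + lambda * (0 - p) + 2 * (lambda * (0 - p)) ^+ 2).
  by rewrite ler_wpM2l //; lra.
have hb' : p * b <= p * (1 + lambda * (1 - p) + 2 * (lambda * (1 - p)) ^+ 2).
  by rewrite ler_wpM2l //; lra.
apply: le_trans (lerD hb' ha') _.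
have l0 : 0 <= lambda ^+ 2 by rewrite sqr_ge0.
have -> : p * (1 + lambda * (1 - p) + 2 * (lambda * (1 - p)) ^+ 2) +
  (1 - p) * (1 + lambda * (0 - p) + 2 * (lambda * (0 - p)) ^+ 2) =
  1 + 2 * (lambda ^+ 2 * (p * (1 - p))) by ring.
rewrite lerD2l ler_pM2l // -[leRHS]mulr1 ler_wpM2l //; nra.
Qed.

Definition excess D eta : R := \sum_(s | D s) ((eta s)%:R - p).

Lemma excess_mgf (lambda : R) D : `|lambda| <= 1 / 2 ->
  \sum_eta weight eta * expR (lambda * excess D eta)
    <= expR (2 * lambda ^+ 2 * #|D|%:R).
Proof.
move=> hl.
pose F s (b : bool) := if D s then expR (lambda * (b%:R - p)) else 1.
have E eta : expR (lambda * excess D eta) = \prod_s F s (eta s).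
  by rewrite /excess mulr_sumr expR_sum /= [LHS]big_mkcond.
rewrite (eq_bigr _ (fun eta _ => congr1 _ (E eta))) (sum_weight_prod F) /F /=.
rewrite [X in _ <= expR X]mulrC expRM_natl -prodr_const [leRHS]big_mkcond /=.
apply: ler_prod => s _; change (s \in D) with (D s); case: (D s).
  by rewrite bernoulli_mgf // andbT; have /andP[? ?] := p01;
    rewrite addr_ge0 ?mulr_ge0 ?expR_ge0 //; lra.
by rewrite !mulr1 addrC subrK ler01 lexx.
Qed.

(** Exponential Markov inequality with lambda = delta * p / 4, which is where
the exponent 2 lambda^2 m - lambda delta p m equals - delta^2 p^2 m / 8. *)
Lemma excess_tail D (delta : R) : 0 <= delta <= 1 ->
  \sum_(eta | delta * (p * #|D|%:R) < `|excess D eta|) weight eta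
    <= 2 * expR (- (delta ^+ 2 * p ^+ 2 / 8 * #|D|%:R)).
Proof.
move=> /andP[d0 d1]; have /andP[p0 p1] := p01.
set m : R := #|D|%:R; set a := delta * (p * m); pose l := delta * p / 4.
have l0 : 0 <= l by rewrite divr_ge0 // mulr_ge0 // ltW.
have l2 : `|l| <= 1 / 2 by rewrite ger0_norm // /l; nra.
have h eta : a < `|excess D eta| ->
    1 <= expR (- (l * a)) *
         (expR (l * excess D eta) + expR (- l * excess D eta)).
  move=> ha; rewrite mulrDr -!expRD.
  have [x0|x0] := leP 0 (excess D eta).
    rewrite (ger0_norm x0) in ha.
    have : 1 <= expR (- (l * a) + l * excess D eta).
      by rewrite -[leLHS]expR0 ler_expR addrC subr_ge0 ler_wpM2l // ltW.
    by have := expR_ge0 (- (l * a) + - l * excess D eta); lra.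
  rewrite (ltr0_norm x0) in ha.
  have : 1 <= expR (- (l * a) + - l * excess D eta).
    by rewrite -[leLHS]expR0 ler_expR addrC mulNr -mulrN subr_ge0 ler_wpM2l // ltW.
  by have := expR_ge0 (- (l * a) + l * excess D eta); lra.
apply: (@le_trans _ _ (\sum_eta weight eta * (expR (- (l * a)) *
    (expR (l * excess D eta) + expR (- l * excess D eta))))).
  rewrite big_mkcond; apply: ler_sum => eta _; case: ifP => [/h h1|_].
    by rewrite -[leLHS]mulr1 ler_wpM2l ?weight_ge0.
  by rewrite !mulr_ge0 ?addr_ge0 ?weight_ge0 ?expR_ge0.
rewrite (eq_bigr _ (fun eta _ => mulrCA _ _ _)) -mulr_sumr.
rewrite (eq_bigr _ (fun eta _ => mulrDr _ _ _)) big_split /=.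
have h1 := excess_mgf D l2.
have h2 : _ <= _ := @excess_mgf (- l) D _.
rewrite normrN sqrrN in h2; have {}h2 := h2 l2.
apply: (@le_trans _ _ (expR (- (l * a)) * (2 * expR (2 * l ^+ 2 * m)))).
  by rewrite ler_wpM2l ?expR_ge0 //; rewrite -/m in h1 h2; lra.
rewrite mulrCA ler_pM2l // -expRD ler_expR le_eqVlt; apply/orP; left; apply/eqP.
by rewrite /l /a; field.
Qed.

End Weights.

(** * Transport plans and the dyadic plan *)

Section SumLemmas.

Lemma geometric_sum_le (R : realFieldType) (q : R) m : 0 <= q < 1 ->
  \sum_(i < m) q ^+ i <= (1 - q)^-1.
Proof.
move=> /andP[q0 q1]; have q1' : 0 < 1 - q by rewrite subr_gt0.
rewrite -[leRHS]mul1r ler_pdivlMr // mulrC.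
have := subrX1 q m; rewrite -opprB -[q - 1]opprB mulNr => /oppr_inj <-.
by rewrite gerBl exprn_ge0.
Qed.

Lemma bernoulli_inequality (R : realFieldType) (x : R) m : 0 <= x ->
  1 + m%:R * x <= (1 + x) ^+ m.
Proof.
move=> x0; elim: m => [|m IH]; first by rewrite mul0r addr0.
have mx : 0 <= m%:R * x * x by rewrite !mulr_ge0.
rewrite exprS; apply: le_trans (ler_wpM2l _ IH); last by lra.
by rewrite -natr1; lra.
Qed.

Lemma sum_blocks (V : nmodType) (g : nat -> V) d m : (0 < d)%N ->
  \sum_(0 <= u < m * d) g (u %/ d)%N = (\sum_(0 <= i < m) g i) *+ d.
Proof.
move=> d0; elim: m => [|m IH]; first by rewrite mul0n !big_geq // mul0rn.
rewrite (big_cat_nat (leq0n (m * d))) /=; last by rewrite leq_mul2r leqnSn orbT.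
rewrite IH big_nat_recr //= mulrnDl; congr (_ + _).
rewrite -{1}[(m * d)%N]add0n big_addn mulSn addnK.
rewrite (eq_big_nat _ _ (F2 := fun=> g m)) => [|u ud].
  by rewrite sumr_const_nat subn0.
by rewrite addnC divnMDl // divn_small ?addn0.
Qed.

(** Each scale occurs d times among the indices, once for every coordinate. *)
Lemma sum_tail_blocks (R : realDomainType) (g : nat -> R) d j n : (0 < d)%N ->
  (j <= n)%N -> (forall i, 0 <= g i) ->
  \sum_(u < n * d | (j * d <= u)%N) g (u %/ d - j)%N
    = d%:R * \sum_(i < n - j) g i.
Proof.
move=> d0 jn g0.
rewrite -(big_mkord (fun u => (j * d <= u)%N) (fun u => g (u %/ d - j)%N)).
have le : (j * d <= n * d)%N by rewrite leq_mul2r jn orbT.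
rewrite (big_cat_nat (leq0n _) le) /= [X in X + _]big1_seq ?add0r; last first.
  by move=> u /andP[h]; rewrite mem_index_iota; lia.
rewrite -{1}[(j * d)%N]add0n big_addn -mulnBl.
rewrite (eq_big (fun=> true) (fun u => g (u %/ d)%N)) => [|u|u _]; last 2 first.
- by rewrite leq_addl.
- by rewrite addnC divnMDl // addKn.
by rewrite sum_blocks // mulr_natl big_mkord.
Qed.

Lemma union_bound (R : realDomainType) (I T : finType) (w : T -> R)
    (P : I -> pred T) : (forall t, 0 <= w t) ->
  \sum_(t | [exists i, P i t]) w t <= \sum_i \sum_(t | P i t) w t.
Proof.
move=> w0; rewrite [leRHS](eq_bigr _ (fun i _ => big_mkcond _ _)).
rewrite exchange_big /= [leLHS]big_mkcond; apply: ler_sum => t _.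
case: existsP => [[i Pi]|_]; last by apply: sumr_ge0 => i _; case: ifP.
by rewrite (bigD1 i) //= Pi lerDl sumr_ge0 // => k _; case: ifP.
Qed.

End SumLemmas.

(** A finite substitute for the stationary transport of mass 1 from every site
and of mass 1/p to every head. The flow is only bounded by these amounts:
bounds survive in the limit, and they become equalities there because the
total mass of the limit is 1. *)
Record transport_plan (R : realType) (d : nat) (p : R) := TransportPlan {
  target : finType;
  source : finType;
  target_pos : target -> lattice d;
  source_pos : source -> lattice d;
  flow : {ffun target -> bool} -> source -> target -> R;
  target_pos_inj : injective target_pos;
  card_source : #|source| = #|target|;
  card_target_gt0 : (0 < #|target|)%N;
  flow_ge0 : forall eta x s, 0 <= flow eta x s;
  flow_out : forall eta x, \sum_s flow eta x s <= 1;
  flow_in : forall eta s, \sum_x flow eta x s <= (eta s)%:R / p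
}.

Arguments flow {R d p} t _ _ _.
Arguments target_pos {R d p} t _.
Arguments source_pos {R d p} t _.

Definition plan_mass (R : realType) (d : nat) (p : R)
    (pl : transport_plan d p) : R :=
  \sum_eta weight p eta * \sum_x \sum_s flow pl eta x s.

Definition plan_cost (R : realType) (d : nat) (p C : R)
    (pl : transport_plan d p) : R :=
  \sum_eta weight p eta * \sum_x \sum_s
    flow pl eta x s *
    expR (C * enorm R (target_pos pl s - source_pos pl x) ^+ d).

Section DyadicPlan.
Variables (R : realType) (n d : nat) (p : R).
Hypothesis p01 : 0 < p < 1.
Hypothesis d0 : (0 < d)%N.
Local Notation L := (n * d)%N.
Local Notation site := (site L).
Local Notation cube := {ffun 'I_d -> 'I_(2 ^ n)}.
Implicit Types (eta : {ffun site -> bool}) (s : site) (x : cube).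

(** The boxes of the heads have volume 2^L / heads, which exceeds 1/p when
there are too few heads; the flow is then scaled down so that a head receives
at most 1/p. The cell of any site at index L is the whole cube. *)
Definition thinning eta : R :=
  Num.min 1 (heads R eta L [ffun=> false] / (p * 2 ^+ L)).

Definition dyadic_flow eta x s : R :=
  thinning eta * \prod_(i < d) box_overlap eta s i 0 (x i)%:R.

Definition site_pos s : lattice d := \row_(i < d) (pos_coord s i)%:Z.
Definition cube_pos x : lattice d := \row_(i < d) (x i : nat)%:Z.

Let p0 : 0 < p. Proof. by case/andP: p01. Qed.
Let p2 u : 0 < p * 2 ^+ u. Proof. by rewrite mulr_gt0 ?exprn_gt0. Qed.

Lemma thinning01 eta : 0 <= thinning eta <= 1.
Proof.
by rewrite /thinning ge_min lexx /= le_min ler01 divr_ge0 ?heads_ge0 ?(ltW (p2 _)).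
Qed.

Lemma dyadic_flow_ge0 eta x s : 0 <= dyadic_flow eta x s.
Proof.
rewrite mulr_ge0 //; first by case/andP: (thinning01 eta).
by apply: prodr_ge0 => i _; rewrite overlap_ge0 // lerDl box_side_ge0.
Qed.

Lemma sum_dyadic_flow eta x : \sum_s dyadic_flow eta x s = thinning eta.
Proof.
rewrite -mulr_sumr (sum_box_overlap _ (t := fun i => (x i)%:R)) ?mulr1 // => i.
by split=> //; rewrite natr1 -natrX ler_nat.
Qed.

(** The unit cubes are disjoint, so together they share at most the whole
volume of the box with it, and the thinning replaces the number of heads
by its mean. *)
Lemma dyadic_flow_in eta s : \sum_x dyadic_flow eta x s <= (eta s)%:R / p.
Proof.
rewrite -mulr_sumr.
pose ov (i : 'I_d) (t : 'I_(2 ^ n)) : R := box_overlap eta s i 0 t%:R.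
rewrite -(bigA_distr_bigA ov) /ov.
apply: (@le_trans _ _ (thinning eta * \prod_(i < d) box_side R eta s i 0)).
  rewrite ler_wpM2l //; first by case/andP: (thinning01 eta).
  apply: ler_prod => i _; rewrite sumr_ge0 /= => [|t _]; last first.
    by rewrite overlap_ge0 // lerDl box_side_ge0.
  have := sum_overlap_le (2 ^ n) (a := box_left R eta s i 0)
    (b := box_left R eta s i 0 + box_side R eta s i 0).
  by rewrite lerDl box_side_ge0 => /(_ isT); rewrite [leRHS]addrAC subrr add0r.
have V0 : 0 <= \prod_(i < d) box_side R eta s i 0.
  by apply: prodr_ge0 => i _; apply: box_side_ge0.
have hL : heads R eta L s = heads R eta L [ffun=> false].
  by rewrite /heads !cell_sumL.
apply: le_trans (ler_wpM2r V0 (_ : _ <= heads R eta L s / (p * 2 ^+ L))) _.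
  by rewrite /thinning hL ge_min lexx orbT.
rewrite mulrAC [_ * \prod_(_ < _) _]mulrC prod_box_side invfM mulrACA.
by rewrite le_eqVlt; apply/orP; left; apply/eqP; field; rewrite expf_neq0 ?gt_eqF.
Qed.

Lemma site_pos_inj : injective site_pos.
Proof.
move=> s s' /rowP h; apply/ffunP => v.
have vd : (v %% d < d)%N by rewrite ltn_mod.
have := h (Ordinal vd); rewrite !mxE => -[] /addr_inj E.
have := E (v %/ d)%N; rewrite ltn_divLR // ltn_ord => /(_ isT).
by rewrite /coord_bit /= -divn_eq !bit_ord.
Qed.

Lemma card_cube : #|{: cube}| = #|{: site}|.
Proof. by rewrite card_site card_ffun !card_ord -expnM. Qed.

Lemma card_site_gt0 : (0 < #|{: site}|)%N.
Proof. by rewrite card_site expn_gt0. Qed.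

Definition dyadic_plan : transport_plan d p.
Proof.
apply: (@TransportPlan R d p _ _ site_pos cube_pos dyadic_flow site_pos_inj
  card_cube card_site_gt0 dyadic_flow_ge0 _ dyadic_flow_in).
by move=> eta x; rewrite sum_dyadic_flow; case/andP: (thinning01 eta).
Defined.

(** The ratio 3/8 is below 1/2, so that the displacements 2^k (3/8)^(k-j)
at the scales above 2^j are summable, while its square times 2^d exceeds 1
when d >= 3, so that the probabilities of exceeding the tolerance are
summable as well. *)
Definition tolerance j u : R := 1 / 8 * (3 / 8) ^+ (u %/ d - j).

Definition balanced_cell eta j u s :=
  `|heads R eta u s - p * 2 ^+ u| <= tolerance j u * (p * 2 ^+ u).

Definition balanced eta j s := [forall u : 'I_L, (j * d <= u)%N ==>
  balanced_cell eta j u s && balanced_cell eta j u (flip u s)].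

(** No cell of index at least n * d is ever cut, so scale 2^n always works. *)
Lemma balanced_top eta s : balanced eta n s.
Proof. by apply/forallP => u; rewrite leqNgt ltn_ord. Qed.

Lemma tolerance_half j u : 0 <= tolerance j u <= 1 / 2.
Proof.
have h : (3 / 8 : R) ^+ (u %/ d - j) <= 1 by apply: exprn_ile1; lra.
have h' : 0 <= (3 / 8 : R) ^+ (u %/ d - j) by apply: exprn_ge0; lra.
by rewrite /tolerance; lra.
Qed.

Lemma enorm_le (z : lattice d) (M : R) : 0 <= M ->
  (forall i, `|(z ord0 i)%:~R| <= M) -> enorm R z <= d%:R * M.
Proof.
move=> M0 h; have dM : 0 <= d%:R * M by rewrite mulr_ge0.
rewrite -[leRHS]ger0_norm // -sqrtr_sqr /enorm ler_wsqrtr //.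
apply: (@le_trans _ _ (\sum_(i < d) M ^+ 2)).
  by apply: ler_sum => i _; rewrite -real_normK ?num_real // lerXn2r ?nnegrE.
rewrite sumr_const card_ord exprMn -[leLHS]mulr_natl.
rewrite ler_wpM2r ?sqr_ge0 //.
by rewrite expr2 ler_peMl // ler1n.
Qed.

Lemma dyadic_flow_local eta j x s : (j <= n)%N -> balanced eta j s ->
  dyadic_flow eta x s != 0 ->
  enorm R (site_pos s - cube_pos x) ^+ d <= (6 * d%:R) ^+ d * 2 ^+ (j * d).
Proof.
move=> jn /forallP bal; rewrite mulf_eq0 => /norP[_ ov].
have J0 : 0 <= 2 ^+ j :> R by rewrite exprn_ge0.
rewrite exprM -exprMn lerXn2r ?nnegrE ?sqrtr_ge0 ?mulr_ge0 //.
rewrite [6 * _]mulrC -mulrA; apply: enorm_le => [|i]; first by rewrite mulr_ge0.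
rewrite !mxE rmorphB /= -!pmulrn.
apply: (box_overlap_local (eta := eta) (t := fun i => (x i)%:R)) jn _ ov i.
move=> u /andP[ju uL]; have := bal (Ordinal uL); rewrite ju /= => /andP[h1 h2].
exact: frac_half uL (p2 u) (tolerance_half j u) h1 h2.
Qed.

Lemma balanced_cell_tail j u s : (u < L)%N ->
  \sum_(eta | ~~ balanced_cell eta j u s) weight p eta
    <= 2 * expR (- (tolerance j u ^+ 2 * p ^+ 2 / 8 * 2 ^+ u)).
Proof.
move=> uL; have card : (#|agree u s|)%:R = 2 ^+ u :> R.
  by rewrite -(cell_card R s (ltnW uL)) /cell_sum sumr_const.
have /andP[t0 t1] := tolerance_half j u.
have t01 : 0 <= tolerance j u <= 1.
  by rewrite t0 (le_trans t1) // ler_pdivrMr // mul1r ler1n.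
have := excess_tail p01 (agree u s) t01; rewrite card; apply: le_trans.
rewrite le_eqVlt; apply/orP; left; apply/eqP/eq_bigl => eta.
rewrite -ltNge /heads /cell_sum /excess sumrB sumr_const -card.
by rewrite -[p *+ _]mulr_natr.
Qed.

(** The Chernoff exponent is delta^2 p^2 2^u / 8, and the square of the
leading factor 1/8 of the tolerance contributes 8^2. *)
Definition tail_rate : R := p ^+ 2 / 8 ^+ 3.
Local Notation kappa := tail_rate.

Lemma tail_rate_gt0 : 0 < kappa.
Proof. by rewrite divr_gt0 ?exprn_gt0. Qed.

(** This is where d >= 3 enters: going up one level multiplies the square of
the tolerance by 9/64 and the volume by 2^d >= 8, so the exponent grows at
least by the factor 9/8 per level and the bounds are summable. *)
Lemma tolerance_exponent j u : (3 <= d)%N -> (j * d <= u)%N ->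
  kappa * 2 ^+ (j * d) + kappa / 8 * (u %/ d - j)%:R
    <= tolerance j u ^+ 2 * p ^+ 2 / 8 * 2 ^+ u.
Proof.
move=> d3 ju; set i := (u %/ d - j)%N.
have ji : (u %/ d)%N = (j + i)%N by rewrite subnKC // leq_divRL.
have P1 : 1 <= 2 ^+ (j * d) :> R by rewrite exprn_ege1 // ler1n.
have h2u : 2 ^+ (j * d) * 8 ^+ i <= 2 ^+ u :> R.
  apply: (@le_trans _ _ (2 ^+ (u %/ d * d))); last first.
    by rewrite ler_weXn2l ?ler1n // leq_divM.
  rewrite ji mulnDl exprD ler_pM2l ?exprn_gt0 // mulnC exprM.
  rewrite lerXn2r ?nnegrE ?exprn_ge0 //.
  have -> : 8 = 2 ^+ 3 :> R by rewrite -natrX.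
  by rewrite ler_weXn2l ?ler1n.
have hb := bernoulli_inequality i (_ : 0 <= 1 / 8 :> R).
have {}hb : 1 + i%:R / 8 <= (9 / 8) ^+ i :> R.
  have -> : 9 / 8 = 1 + 1 / 8 :> R by field.
  by apply: le_trans (hb _); rewrite ?mul1r // invr_ge0.
have t2 : tolerance j u ^+ 2 * p ^+ 2 / 8 = kappa * (9 / 64) ^+ i.
  rewrite /tolerance -/i exprMn -exprM mulnC exprM.
  have -> : (3 / 8) ^+ 2 = 9 / 64 :> R by field.
  by rewrite /tail_rate; field.
rewrite t2.
have k0 := tail_rate_gt0.
apply: (@le_trans _ _
  (kappa * (9 / 64) ^+ i * (2 ^+ (j * d) * 8 ^+ i))); last first.
  by rewrite ler_wpM2l // mulr_ge0 ?(ltW k0) ?exprn_ge0 // divr_ge0.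
have -> : kappa * (9 / 64) ^+ i * (2 ^+ (j * d) * 8 ^+ i) =
    kappa * (2 ^+ (j * d) * (9 / 8) ^+ i).
  rewrite -mulrA; congr (_ * _); rewrite mulrCA -exprMn.
  by have -> : 9 / 64 * 8 = 9 / 8 :> R by field.
have -> : kappa * 2 ^+ (j * d) + kappa / 8 * i%:R =
    kappa * (2 ^+ (j * d) + i%:R / 8) by field.
rewrite ler_pM2l //; apply: le_trans (ler_wpM2l _ hb); last by lra.
rewrite mulrDr mulr1 lerD2l -[leLHS]mul1r ler_wpM2r // divr_ge0 //.
Qed.

Definition tail_const : R := 4 * d%:R / (1 - expR (- (kappa / 8))).

(** Union bound over the cells; the linear lower bound for the exponent turns
the sum over the levels into a geometric series. *)
Lemma unbalanced_tail j s : (3 <= d)%N -> (j <= n)%N ->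
  \sum_(eta | ~~ balanced eta j s) weight p eta
    <= tail_const * expR (- (kappa * 2 ^+ (j * d))).
Proof.
move=> d3 jn; set a := expR (- (kappa * _)); pose q := expR (- (kappa / 8)).
have k0 := tail_rate_gt0.
have q01 : 0 <= q < 1 by rewrite expR_ge0 /= expR_lt1 oppr_lt0 divr_gt0.
pose bad u eta := (j * d <= u)%N &&
  (~~ balanced_cell eta j u s || ~~ balanced_cell eta j u (flip u s)).
rewrite (eq_bigl (fun eta => [exists u : 'I_L, bad u eta])) => [|eta]; last first.
  rewrite /balanced negb_forall; apply: eq_existsb => u.
  by rewrite negb_imply negb_and.
apply: le_trans (union_bound _ _) _; first by move=> eta; exact: weight_ge0.
apply: (@le_trans _ _
  (\sum_(u < L | (j * d <= u)%N) (4 * a * q ^+ (u %/ d - j)))).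
  rewrite [leRHS]big_mkcond; apply: ler_sum => u _; rewrite /bad.
  case: ifP => ju; last by rewrite big_pred0.
  apply: (@le_trans _ _ (\sum_(eta | ~~ balanced_cell eta j u s) weight p eta +
     \sum_(eta | ~~ balanced_cell eta j u (flip u s)) weight p eta)).
    rewrite /= big_mkcond [X in _ <= X + _]big_mkcond [X in _ <= _ + X]big_mkcond.
    rewrite -big_split; apply: ler_sum => eta _ /=.
    have w0 := weight_ge0 p01 eta.
    by do 2 case: (balanced_cell _ _ _ _) => /=; lra.
  have uL := ltn_ord u.
  have h1 := balanced_cell_tail j s uL.
  have h2 := balanced_cell_tail j (flip u s) uL.
  apply: le_trans (lerD h1 h2) _; set e := expR _.
  suff : e <= a * q ^+ (u %/ d - j) by lra.
  rewrite /e /a /q -expRM_natl -expRD ler_expR.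
  by have := tolerance_exponent d3 ju; lra.
rewrite (sum_tail_blocks (g := fun i => 4 * a * q ^+ i)) // => [|i]; last first.
  by rewrite !mulr_ge0 ?expR_ge0 ?exprn_ge0 //; case/andP: q01.
rewrite -mulr_sumr /tail_const -/q.
have := geometric_sum_le (n - j) q01; set g := \sum_(_ < _) _ => hg.
have -> : d%:R * (4 * a * g) = 4 * d%:R * a * g by ring.
have -> : 4 * d%:R / (1 - q) * a = 4 * d%:R * a / (1 - q) by rewrite mulrAC.
by rewrite ler_wpM2l // !mulr_ge0 // expR_ge0.
Qed.

End DyadicPlan.

(** * Exponential cost and total mass of the dyadic plan *)

Section DyadicEstimates.
Variables (R : realType) (n d : nat) (p : R).
Hypothesis p01 : 0 < p < 1.
Hypothesis d3 : (3 <= d)%N.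
Local Notation L := (n * d)%N.
Local Notation site := (site L).
Implicit Types (eta : {ffun site -> bool}) (s : site).

Let d0 : (0 < d)%N. Proof. exact: leq_trans d3. Qed.
Let p0 : 0 < p. Proof. by case/andP: p01. Qed.
Local Notation kappa := (tail_rate p).

(** With this rate the penalty of scale 2^(j+1) is the inverse square root of the
exponential factor in the bound for the probability that scale 2^j fails. *)
Definition cost_rate : R := kappa / (2 * (6 * d%:R) ^+ d * 2 ^+ d).

Definition cost_bound : R :=
  (expR (cost_rate * (6 * d%:R) ^+ d)
   + tail_const d p / (1 - expR (- (kappa / 2)))) / p.

Let A0 : 0 < (6 * d%:R) ^+ d :> R.
Proof. by rewrite exprn_gt0 // mulr_gt0 // ltr0n. Qed.

Lemma cost_rate_gt0 : 0 < cost_rate.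
Proof. by rewrite divr_gt0 ?tail_rate_gt0 // !mulr_gt0 // exprn_gt0. Qed.

Lemma tail_const_ge0 : 0 <= tail_const d p.
Proof.
rewrite /tail_const divr_ge0 // subr_ge0 -[leRHS]expR0 ler_expR oppr_le0.
by rewrite divr_ge0 // ltW // tail_rate_gt0.
Qed.

Let penalty j := expR (cost_rate * ((6 * d%:R) ^+ d * 2 ^+ (j * d))).

(** If 2^j is the smallest balanced scale of s then j = 0 or scale
2^(j-1) fails, so the exponential of the cost is at most one of the terms
of this sum. *)
Let site_penalty eta s := \sum_(j < n.+1)
  if (j == ord0) || ~~ balanced p eta j.-1 s then penalty j else 0.

Let site_penalty_ge0 eta s : 0 <= site_penalty eta s.
Proof. by apply: sumr_ge0 => j _; case: ifP => // _; apply: expR_ge0. Qed.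

Lemma flow_cost eta x s :
  dyadic_flow p eta x s *
    expR (cost_rate * enorm R (site_pos s - cube_pos x) ^+ d)
    <= dyadic_flow p eta x s * site_penalty eta s.
Proof.
have [->|f0] := eqVneq (dyadic_flow p eta x s) 0; first by rewrite !mul0r.
rewrite ler_wpM2l ?dyadic_flow_ge0 //.
have exj : exists j, balanced p eta j s by exists n; apply: balanced_top.
(* j is the smallest balanced scale around s *)
case: (ex_minnP exj) => j bal jmin.
have jn : (j <= n)%N by apply/jmin/balanced_top.
have jn1 : (j < n.+1)%N by [].
rewrite /site_penalty (bigD1 (Ordinal jn1)) //= ifT; last first.
  case: j bal jmin jn jn1 => [//|j] bal jmin jn jn1; apply/orP; right => /=.
  by apply: contraT; rewrite negbK => /jmin; rewrite ltnn.
rewrite -[leLHS]addr0 lerD //; last first.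
  by apply: sumr_ge0 => i _; case: ifP => // _; apply: expR_ge0.
rewrite ler_expR ler_wpM2l ?(ltW cost_rate_gt0) //.
exact: dyadic_flow_local bal f0.
Qed.

Lemma expected_penalty s :
  \sum_eta weight p eta * site_penalty eta s <= cost_bound * p.
Proof.
have k0 := tail_rate_gt0 p01; have B0 := tail_const_ge0.
rewrite /cost_bound divfK ?gt_eqF // /site_penalty.
rewrite (eq_bigr _ (fun eta _ => mulr_sumr _ _ _ _)) exchange_big big_ord_recl /=.
rewrite lerD //.
  by rewrite -mulr_suml sum_weight // mul1r ler_expR mul0n expr0 mulr1.
pose q := expR (- (kappa / 2)).
have q01 : 0 <= q < 1 by rewrite expR_ge0 /= expR_lt1 oppr_lt0 divr_gt0.
apply: le_trans (ler_wpM2l B0 (geometric_sum_le n q01)).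
rewrite mulr_sumr; apply: ler_sum => j _; rewrite /bump /= add1n.
have jn : (j <= n)%N by apply: ltnW.
apply: (@le_trans _ _ (penalty j.+1 *
    \sum_(eta | ~~ balanced p eta j s) weight p eta)).
  rewrite mulr_sumr [leRHS]big_mkcond; apply: ler_sum => eta _ /=.
  by case: ifP => _; rewrite ?mulr0 // mulrC.
have := unbalanced_tail p01 d0 s d3 jn.
move/(ler_wpM2l (expR_ge0 (cost_rate * ((6 * d%:R) ^+ d * 2 ^+ (j.+1 * d))))).
move/le_trans; apply; rewrite mulrCA ler_wpM2l // -expRD -expRM_natl ler_expR.
(* the penalty uses up half of the exponent of the tail bound *)
have -> : cost_rate * ((6 * d%:R) ^+ d * 2 ^+ (j.+1 * d)) =
    kappa / 2 * 2 ^+ (j * d).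
  rewrite /cost_rate mulSn exprD.
  set a := _ ^+ d; set b := 2 ^+ d; set c := 2 ^+ _.
  by field; rewrite !gt_eqF ?A0 // exprn_gt0.
have hj : j%:R <= 2 ^+ (j * d) :> R.
  rewrite -natrX ler_nat (leq_trans (ltnW (ltn_expl j (ltnSn 1)))) //.
  by rewrite leq_exp2l // leq_pmulr.
rewrite [leRHS]mulrN mulrC.
have : kappa / 2 * j%:R <= kappa / 2 * 2 ^+ (j * d).
  by rewrite ler_wpM2l // ltW // divr_gt0.
lra.
Qed.

Lemma dyadic_cost :
  plan_cost cost_rate (dyadic_plan n p01 d0) <= cost_bound * #|{: site}|%:R.
Proof.
apply: (@le_trans _ _ (\sum_eta weight p eta * \sum_s site_penalty eta s / p)).
  apply: ler_sum => eta _; rewrite ler_wpM2l ?weight_ge0 // exchange_big /=.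
  apply: ler_sum => s _.
  apply: (le_trans (ler_sum _ (fun x _ => flow_cost eta x s))).
  rewrite -mulr_suml mulrC ler_wpM2l //.
  apply: le_trans (dyadic_flow_in p01 eta s) _.
  by rewrite ler_pdivrMr // mulVf ?gt_eqF // lern1 leq_b1.
rewrite (eq_bigr _ (fun eta _ => mulr_sumr _ _ _ _)) exchange_big /=.
rewrite mulr_natr -sumr_const; apply: ler_sum => s _.
rewrite (eq_bigr _ (fun eta _ => mulrA _ _ _)) -mulr_suml ler_pdivrMr //.
exact: expected_penalty.
Qed.

(** The mass is lost only through the thinning, which is at least 1 - delta
unless the relative error of the number of heads exceeds delta. *)
Lemma dyadic_mass (delta : R) : 0 <= delta <= 1 ->
  (1 - delta - 2 * expR (- (delta ^+ 2 * p ^+ 2 / 8 * 2 ^+ L))) * #|{: site}|%:R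
    <= plan_mass (dyadic_plan n p01 d0).
Proof.
move=> d01; rewrite /plan_mass.
rewrite (eq_bigr (fun eta =>
  weight p eta * thinning p eta * #|{: site}|%:R)); last first.
  move=> eta _; rewrite (eq_bigr _ (fun x _ => sum_dyadic_flow p eta x)).
  by rewrite sumr_const -mulrA -[thinning p eta *+ _]mulr_natr card_cube.
rewrite -mulr_suml ler_wpM2r //.
have := excess_tail p01 (fun _ : site => true) d01.
have -> : #|(fun _ : site => true)|%:R = 2 ^+ L :> R.
  by rewrite cardE -cardT card_site natrX.
set tail := \sum_(eta | _) _ => htail.
apply: (@le_trans _ _ (1 - delta - tail)); first by lra.
have [dl0 dl1] := andP d01.
have {1}-> : 1 = \sum_eta weight p (S := site) eta by rewrite sum_weight.
have -> : delta = \sum_eta weight p (S := site) eta * delta.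
  by rewrite -mulr_suml sum_weight ?mul1r.
rewrite /tail [X in _ - X <= _]big_mkcond -!sumrB.
apply: ler_sum => eta _.
have w0 := weight_ge0 p01 eta.
have /andP[t0 t1] := thinning01 p01 eta.
have wt : 0 <= weight p eta * thinning p eta by rewrite mulr_ge0.
have wd : 0 <= weight p eta * delta by rewrite mulr_ge0.
case: ifPn; first by lra.
rewrite -leNgt subr0 => hx; rewrite -{1}[weight p eta]mulr1 -mulrBr ler_wpM2l //.
have P0 : 0 < p * 2 ^+ L by rewrite mulr_gt0 ?exprn_gt0.
rewrite /thinning le_min gerBl dl0 /= ler_pdivlMr //.
rewrite /heads cell_sumL.
move: hx; rewrite /excess sumrB sumr_const.
have -> : p *+ #|[pred _ : site | true]| = p * 2 ^+ L.
  by rewrite -[p *+ _]mulr_natr -natrX -card_site.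
by rewrite ler_norml => /andP[h1 h2]; lra.
Qed.

End DyadicEstimates.

(** The cost bound K does not depend on the size of the cube, while the mass
lost can be made arbitrarily small by taking a large cube. *)
Theorem transport_plans_exist (R : realType) (d : nat) (p : R) :
  0 < p < 1 -> (3 <= d)%N ->
  exists C K : R, 0 < C /\ forall eps : R, 0 < eps ->
    exists pl : transport_plan d p,
      (1 - eps) * #|target pl|%:R <= plan_mass pl /\
      plan_cost C pl <= K * #|target pl|%:R.
Proof.
move=> p01 d3; have /andP[p0 p1] := p01.
exists (cost_rate d p), (cost_bound d p); split; first exact: cost_rate_gt0.
move=> eps0; wlog eps1 : eps0 / eps0 <= 1.
  move=> H e0; have [|e1] := leP eps0 1; first by move/H; apply.
  have [|pl [h1 h2]] := H 1 (lexx _); first by [].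
  exists pl; split=> //; apply: le_trans h1; rewrite ler_wpM2r //; lra.
move=> e0; pose delta := eps0 / 2; pose c := delta ^+ 2 * p ^+ 2 / 8.
have dl0 : 0 < delta by rewrite divr_gt0.
have c0 : 0 < c by rewrite !mulr_gt0 ?exprn_gt0.
have d0 : (0 < d)%N by exact: leq_trans d3.
(* 2 exp(- x) <= 2 / x, which is at most delta as soon as x >= 2 / delta *)
pose n := Num.bound (2 / (delta * c)).
have hn : 2 / (delta * c) < n%:R.
  by apply: archi_boundP; rewrite divr_ge0 // mulr_ge0 // ltW.
exists (dyadic_plan n p01 d0); split; last exact: dyadic_cost.
apply: le_trans (dyadic_mass n p01 d3 (delta := delta) _); last first.
  by rewrite (ltW dl0) /= /delta; lra.
rewrite ler_wpM2r //.
suff : 2 * expR (- (c * 2 ^+ (n * d))) <= delta by rewrite /c /delta; lra.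
rewrite expRN -ler_pdivlMl // -[leRHS]invrK.
rewrite lef_pV2 ?posrE ?expR_gt0 ?invr_gt0 ?mulr_gt0 //.
apply: le_trans (expR_ge1Dx _).
have hj : n%:R <= 2 ^+ (n * d) :> R.
  rewrite -natrX ler_nat (leq_trans (ltnW (ltn_expl n (ltnSn 1)))) //.
  by rewrite leq_exp2l // leq_pmulr.
rewrite invfM invrK.
have : 2 / delta <= c * n%:R.
  by move: hn; rewrite ltr_pdivrMr ?mulr_gt0 // ler_pdivrMr // => /ltW; lra.
have : c * n%:R <= c * 2 ^+ (n * d) by rewrite ler_pM2l.
lra.
Qed.

(** * Ultrafilter limits and finitely additive set functions *)

Section UltrafilterLimits.
Variables (R : realType) (U : set_system nat).
Hypotheses (ultraU : UltraFilter U) (oo_U : \oo `<=` U).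

(** Used for an ultrafilter U, along which all bounded sequences converge. *)
Definition ulim (u : nat -> R) : R := lim (u @ U).

Lemma ultra_fmap (T T' : Type) (F : set_system T) (f : T -> T') :
  UltraFilter F -> UltraFilter (f @ F).
Proof.
move=> uF; split=> [|G PG FG]; first exact: fmap_proper_filter.
apply/seteqP; split=> // A GA.
have [//|nA] := in_ultra_setVsetC (f @^-1` A) uF.
have : G (A `&` ~` A) by apply: filterI => //; apply: FG.
by rewrite setICr => /filter_not_empty.
Qed.

Lemma ulim_cvg (u : nat -> R) : (forall m, 0 <= u m <= 1) -> u @ U --> ulim u.
Proof.
move=> u01; have := @segment_compact R 0 1; rewrite compact_ultra.
move=> /(_ _ (ultra_fmap u ultraU)) [].
  change (U (u @^-1` `[0, 1]%classic)).
  by apply: filterE => m /=; rewrite in_itv /= u01.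
by move=> l [_ ul]; apply/cvg_ex; exists l.
Qed.

Lemma ulim_le (u : nat -> R) c :
  (forall m, 0 <= u m <= 1) -> (forall m, u m <= c) -> ulim u <= c.
Proof.
move=> /ulim_cvg uU uc; apply: limr_le; last exact: nearW.
by apply/cvg_ex; exists (ulim u).
Qed.

Lemma ulim_ge (u : nat -> R) c : (forall m, 0 <= u m <= 1) ->
  (\forall m \near \oo, c <= u m) -> c <= ulim u.
Proof.
move=> /ulim_cvg uU uc; apply: limr_ge; first by apply/cvg_ex; exists (ulim u).
exact: oo_U.
Qed.

Lemma ulimD (u v : nat -> R) : (forall m, 0 <= u m <= 1) ->
  (forall m, 0 <= v m <= 1) -> ulim (fun m => u m + v m) = ulim u + ulim v.
Proof.
by move=> /ulim_cvg hu /ulim_cvg hv; apply: cvg_lim => //; apply: cvgD.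
Qed.

Lemma ulim_lin (I : Type) (r : seq I) (c : I -> R) (u : I -> nat -> R) :
  (forall i m, 0 <= u i m <= 1) ->
  (fun m => \sum_(i <- r) c i * u i m) @ U --> \sum_(i <- r) c i * ulim (u i).
Proof.
move=> hu; elim: r => [|i r IH].
  by rewrite big_nil; under eq_fun do rewrite big_nil; exact: cvg_cst.
rewrite big_cons; under eq_fun do rewrite big_cons.
by apply: cvgD => //; apply: cvgMr; exact: ulim_cvg.
Qed.

End UltrafilterLimits.

Section Contents.
Context (dT : measure_display) (T : measurableType dT) (R : realType).

(** Nonnegativity and additivity are required on measurable sets only: the
values that a measure takes elsewhere carry no information. *)
Record real_content (q : set T -> R) : Prop := RealContent {
  rcontent_ge0 : forall A, measurable A -> 0 <= q A;
  rcontentU : forall A B, measurable A -> measurable B -> A `&` B = set0 ->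
    q (A `|` B) = q A + q B }.

Section Theory.
Variable q : set T -> R.
Hypothesis qc : real_content q.

Lemma rcontent0 : q set0 = 0.
Proof.
have := rcontentU qc measurable0 measurable0 (setI0 _).
by rewrite setU0 => /eqP; rewrite -subr_eq subrr => /eqP.
Qed.

Lemma rcontentD A B : measurable A -> measurable B -> B `<=` A ->
  q (A `\` B) = q A - q B.
Proof.
move=> mA mB BA; apply/eqP; rewrite eq_sym subr_eq; apply/eqP.
rewrite -(rcontentU qc) //; first by rewrite setDKU.
  exact: measurableD.
by rewrite setDE -setIA setICl setI0.
Qed.

Lemma le_rcontent A B : measurable A -> measurable B -> B `<=` A -> q B <= q A.
Proof.
move=> mA mB BA; rewrite -subr_ge0 -rcontentD //.
by apply: (rcontent_ge0 qc); exact: measurableD.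
Qed.

Lemma rcontent_bigcup (F : nat -> set T) n : (forall i, measurable (F i)) ->
  trivIset setT F -> q (\bigcup_(i < n) F i) = \sum_(0 <= i < n) q (F i).
Proof.
move=> mF tF; elim: n => [|n IH].
  by rewrite big_geq // bigcup_mkord big_ord0 rcontent0.
rewrite big_nat_recr //= -IH bigcup_mkord big_ord_recr /= -bigcup_mkord.
apply: (rcontentU qc) => //.
  by rewrite bigcup_mkord; apply: bigsetU_measurable.
rewrite setI_bigcupl bigcup0 // => i /= iltn.
by move/trivIsetP : tF; apply => //; rewrite ltn_eqF.
Qed.

Lemma rcontent_fibers (I : eqType) (f : T -> I) (B : set T) (s : seq I) :
  (forall i, measurable (f @^-1` [set i])) -> measurable B -> uniq s ->
  \sum_(i <- s) q (B `&` f @^-1` [set i]) = q (B `&` f @^-1` [set` s]).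
Proof.
move=> mf mB; have E0 : f @^-1` [set` ([::] : seq I)] = set0.
  by apply/seteqP; split.
have E i t : f @^-1` [set` i :: t] = f @^-1` [set i] `|` f @^-1` [set` t].
  apply/seteqP; split=> w /=.
    by rewrite in_cons => /orP[/eqP|]; [left|right].
  by case=> [->|h]; rewrite in_cons ?eqxx // h orbT.
have ms (t : seq I) : measurable (f @^-1` [set` t]).
  by elim: t => [|i t IH]; rewrite ?E0 // E; exact: measurableU.
elim: s => [|i s IH] /=; first by rewrite big_nil E0 setI0 rcontent0.
case/andP => si /IH {}IH; rewrite big_cons IH E setIUr; apply/esym/(rcontentU qc).
- exact: measurableI.
- exact: measurableI.
- by apply/seteqP; split=> // w [[_ wi] [_]] /=; rewrite wi (negbTE si).
Qed.

Lemma rcontent_partition (I : finType) (f : T -> I) (B : set T) :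
  (forall i, measurable (f @^-1` [set i])) -> measurable B ->
  \sum_i q (B `&` f @^-1` [set i]) = q B.
Proof.
move=> mf mB; rewrite rcontent_fibers ?index_enum_uniq //; congr q.
rewrite -[RHS]setIT; congr (_ `&` _); apply/seteqP; split=> w //= _.
exact: mem_index_enum.
Qed.

End Theory.

Lemma rcontent_restrict (q : set T -> R) (D : set T) : measurable D ->
  real_content q -> real_content (fun A => q (A `&` D)).
Proof.
move=> mD qc; split=> [A mA|A B mA mB AB].
  by apply: (rcontent_ge0 qc); exact: measurableI.
rewrite setIUl (rcontentU qc) //; [exact: measurableI|exact: measurableI|].
by rewrite setIACA AB set0I.
Qed.

Lemma rcontentZ (q : set T -> R) (c : R) : 0 <= c ->
  real_content q -> real_content (fun A => c * q A).
Proof.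
move=> c0 qc; split=> [A mA|A B mA mB AB].
  by rewrite mulr_ge0 // (rcontent_ge0 qc).
by rewrite (rcontentU qc) // mulrDr.
Qed.

Lemma rcontent_sum (I : finType) (q : I -> set T -> R) :
  (forall i, real_content (q i)) -> real_content (fun A => \sum_i q i A).
Proof.
move=> qc; split=> [A mA|A B mA mB AB].
  by apply: sumr_ge0 => i _; exact: (rcontent_ge0 (qc i)).
by rewrite -big_split /=; apply: eq_bigr => i _; rewrite (rcontentU (qc i)).
Qed.

End Contents.

Lemma rcontent_preimage (d1 d2 : measure_display) (T1 : measurableType d1)
    (T2 : measurableType d2) (R : realType) (Y : T1 -> T2) (q : set T1 -> R) :
  measurable_fun setT Y -> real_content q ->
  real_content (fun A => q (Y @^-1` A)).
Proof.
move=> mY qc; have mYA A : measurable A -> measurable (Y @^-1` A).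
  by move=> mA; rewrite -[_ @^-1` _]setTI; exact: mY.
split=> [A mA|A B mA mB AB]; first by apply: (rcontent_ge0 qc); exact: mYA.
rewrite preimage_setU; apply: (rcontentU qc); [exact: mYA|exact: mYA|].
by rewrite -preimage_setI AB preimage_set0.
Qed.

Lemma rcontent_probability (dT : measure_display) (T : measurableType dT)
    (R : realType) (P : probability T R) : real_content (fun A => fine (P A)).
Proof.
split=> [A mA|A B mA mB AB]; first exact/fine_ge0/measure_ge0.
by rewrite measureU // fineD // fin_num_measure.
Qed.

(** The mass of the tails of a disjoint union is dominated by the mass that P
gives to them, which tends to 0; hence finite additivity implies countable
additivity. *)
Lemma dominated_content_measure (d1 d2 : measure_display)
    (T1 : measurableType d1) (T2 : measurableType d2) (R : realType)
    (P : probability T1 R) (Y : T1 -> T2) (q : set T2 -> R) :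
  measurable_fun setT Y -> real_content q ->
  (forall A, measurable A -> q A <= fine (P (Y @^-1` A))) ->
  exists nu : {measure set T2 -> \bar R}, forall A, measurable A -> nu A = (q A)%:E.
Proof.
move=> mY qc qP; pose f A : \bar R := if `[< measurable A >] then (q A)%:E else 0%E.
have fE A : measurable A -> f A = (q A)%:E by move=> mA; rewrite /f asboolT.
have f0 : f set0 = 0%E by rewrite fE // (rcontent0 qc).
have f_ge0 A : (0 <= f A)%E.
  by rewrite /f; case: asboolP => // mA; rewrite lee_fin (rcontent_ge0 qc).
have fs : semi_sigma_additive f.
  move=> F mF tF mU; rewrite fE //.
  rewrite (_ : (fun n => _) = (fun n => (\sum_(0 <= i < n) q (F i))%:E)); last first.
    by apply/funext => n; rewrite -sumEFin; apply: eq_bigr => i _; rewrite fE.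
  pose pi A := fine (P (Y @^-1` A)).
  have pic : real_content pi := rcontent_preimage mY (rcontent_probability P).
  have mYA A : measurable A -> measurable (Y @^-1` A).
    by move=> mA; rewrite -[_ @^-1` _]setTI; exact: mY.
  have pi_cvg : (fun n => \sum_(0 <= i < n) pi (F i)) @ \oo --> pi (\bigcup_n F n).
    have : (fun n => (\sum_(0 <= i < n) P (Y @^-1` F i))%E) @ \oo -->
        (pi (\bigcup_n F n))%:E.
      rewrite /pi fineK ?fin_num_measure //; last exact: mYA.
      rewrite preimage_bigcup; apply: measure_semi_sigma_additive.
      - by move=> i; exact: mYA.
      - apply/trivIsetP => i j _ _ ij; rewrite -preimage_setI.
        by move/trivIsetP : tF => ->//; rewrite preimage_set0.
      - by rewrite -preimage_bigcup; exact: mYA.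
    move/fine_cvg; apply: cvg_trans; apply: near_eq_cvg; apply: nearW => n /=.
    by rewrite -sum_fine // => i _; rewrite fin_num_measure //; exact: mYA.
  apply: cvg_EFin; first by apply: nearW.
  apply: (@squeeze_cvgr _ _ _ _
    (fun n => q (\bigcup_n F n) - (pi (\bigcup_n F n) - \sum_(0 <= i < n) pi (F i)))
    (fun=> q (\bigcup_n F n))); last 2 first.
  - rewrite -[X in _ --> X]subr0 -[X in _ --> _ - X](subrr (pi (\bigcup_n F n))).
    by apply: cvgB; [exact: cvg_cst|apply: cvgB => //; exact: cvg_cst].
  - exact: cvg_cst.
  apply: nearW => n /=.
  have mn : measurable (\bigcup_(i < n) F i).
    by rewrite bigcup_mkord; apply: bigsetU_measurable.
  have sn : \bigcup_(i < n) F i `<=` \bigcup_i F i by apply: bigcup_subset.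
  rewrite -(rcontent_bigcup qc) // -(rcontent_bigcup pic) // (le_rcontent qc) // andbT.
  rewrite lerBlDr -lerBlDl -(rcontentD pic) // -(rcontentD qc) //.
  by apply: qP; exact: measurableD.
pose nu : {measure set T2 -> \bar R} :=
  HB.pack f (isMeasure.Build _ _ _ f f0 f_ge0 fs).
by exists nu.
Qed.

(** * Limits of joint laws with a lattice-valued coordinate *)

Lemma measurable_lattice_fun (dT : measure_display) (T : measurableType dT)
  (d : nat) (f : lattice d -> T) : measurable_fun setT f.
Proof. by []. Qed.

Section LimitCoupling.
Context (dO : measure_display) (Omega : measurableType dO) (R : realType).
Variables (P : probability Omega R) (d : nat).
Local Notation joint := (Omega * lattice d)%type.
Variable M : nat -> set joint -> R.
Hypothesis Mc : forall m, real_content (M m).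
Hypothesis M_fst : forall m A, measurable A -> M m (fst @^-1` A) <= fine (P A).
Hypothesis M_tight : forall eps : R, 0 < eps -> exists zs : seq (lattice d),
  \forall m \near \oo, 1 - eps <= M m (snd @^-1` [set` zs]).

Let measurable_snd_pre (D : set (lattice d)) :
  measurable (snd @^-1` D : set joint).
Proof. by rewrite -[_ @^-1` _]setTI; exact: measurable_snd. Qed.

Let measurable_fst_pre (A : set Omega) : measurable A ->
  measurable (fst @^-1` A : set joint).
Proof. by move=> mA; rewrite -[_ @^-1` _]setTI; exact: measurable_fst. Qed.

Let M01 m A : measurable A -> 0 <= M m A <= 1.
Proof.
move=> mA; rewrite (rcontent_ge0 (Mc m) mA) /=.
apply: (@le_trans _ _ (M m setT)); first exact: (le_rcontent (Mc m)).
by have := M_fst m measurableT; rewrite preimage_setT probability_setT.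
Qed.

Local Notation slice z := (snd @^-1` [set z] : set joint).

(** Restricted to the event that the lattice coordinate is z, the limit is
dominated by P and therefore a measure; Q is the sum of these measures over z.
Inequalities between finite sums pass to the limit along the ultrafilter and
then to the series over z. Mass could only escape to infinity in the lattice,
which tightness excludes. *)
Lemma limit_coupling : exists Q : probability joint R,
  (forall B c, measurable B -> (forall m, M m B <= c) -> (Q B <= c%:E)%E) /\
  (forall (f : lattice d -> R) K, (forall z, 0 <= f z) ->
     (forall m zs, uniq zs -> \sum_(z <- zs) f z * M m (slice z) <= K) ->
     (\int[Q]_w (f w.2)%:E <= K%:E)%E).
Proof.
have [U [ultraU oo_U]] := ultraFilterLemma (F := \oo) _.
pose q z B := ulim U (fun m => M m (B `&` slice z)).
have Mq01 z B : measurable B -> forall m, 0 <= M m (B `&` slice z) <= 1.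
  by move=> mB m; apply: M01; exact: measurableI.
have qc z : real_content (q z).
  split=> [A mA|A B mA mB AB].
    apply: ulim_ge => //; first exact: Mq01.
    by apply: nearW => m; case/andP: (Mq01 z A mA m).
  rewrite /q -ulimD; [|exact: Mq01|exact: Mq01].
  congr ulim; apply/funext => m; rewrite setIUl (rcontentU (Mc m)) //.
  - exact: measurableI.
  - exact: measurableI.
  - by rewrite setIACA AB set0I.
have mpair (z : lattice d) : measurable_fun setT (fun w : Omega => (w, z)).
  exact: measurable_fun_pair.
have qP z B : measurable B -> q z B <= fine (P ((fun w => (w, z)) @^-1` B)).
  move=> mB; apply: ulim_le; first exact: Mq01.
  have mpB : measurable ((fun w => (w, z)) @^-1` B).
    by rewrite -[_ @^-1` _]setTI; exact: mpair.
  move=> m; apply: le_trans (M_fst m mpB); apply: (le_rcontent (Mc m)).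
  - exact: measurable_fst_pre.
  - exact: measurableI.
  - by move=> [w y] /= [Bw yz]; rewrite -yz.
have [nu nuE] := choice (fun z => dominated_content_measure (mpair z) (qc z) (qP z)).
(* the lattice is enumerated by its coding; integers that are not the code of a
   point carry the zero measure *)
pose mu_ (k : nat) : {measure set joint -> \bar R} :=
  if pickle_inv k is Some z then nu z else mzero.
pose zs n : seq (lattice d) := pmap pickle_inv (iota 0 n).
have zs_uniq n : uniq (zs n) by rewrite (pmap_uniq (@pickle_invK _)) // iota_uniq.
have partial B n : measurable B ->
    (\sum_(0 <= k < n) mu_ k B)%E = (\sum_(z <- zs n) q z B)%:E.
  move=> mB; rewrite -sumEFin big_pmap /index_iota subn0; apply: eq_bigr => k _.
  by rewrite /mu_; case: pickle_inv => [z|] //=; rewrite nuE.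
have q_le f B K n : measurable B ->
    (forall m, \sum_(z <- zs n) f z * M m (B `&` slice z) <= K) ->
    \sum_(z <- zs n) f z * q z B <= K.
  move=> mB h; have fq := @ulim_lin R U ultraU _ (zs n) f
    (fun z m => M m (B `&` slice z)) (fun z => Mq01 z B mB).
  rewrite -(cvg_lim _ fq) //; apply: limr_le; last exact: nearW.
  by apply/cvg_ex; eexists; exact: fq.
have q_leU B c n : measurable B -> (forall m, M m B <= c) ->
    \sum_(z <- zs n) q z B <= c.
  move=> mB h; rewrite (eq_bigr _ (fun z _ => esym (mul1r _))); apply: q_le => // m.
  rewrite (eq_bigr _ (fun z _ => mul1r _)) (rcontent_fibers (Mc m)) //.
  apply: le_trans (h m).
  by apply: (le_rcontent (Mc m)) => //; exact: measurableI.
have mseries_le (u : nat -> \bar R) (c : \bar R) : (forall k, (0 <= u k)%E) ->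
    (forall n, (\sum_(0 <= k < n) u k <= c)%E) -> (\sum_(0 <= k <oo) u k <= c)%E.
  move=> u0 h; apply: lime_le; first by apply: is_cvg_nneseries => k _ _.
  by apply: nearW => n; exact: h.
have Q_le B c : measurable B -> (forall m, M m B <= c) -> (mseries mu_ 0 B <= c%:E)%E.
  by move=> mB h; apply: mseries_le => // n; rewrite partial // lee_fin q_leU.
have Q_setT : mseries mu_ 0 setT = 1%E.
  apply/eqP; rewrite eq_le Q_le //=; last first.
    by move=> m; case/andP: (M01 m measurableT).
  (* the enumeration up to n covers the finite set given by tightness *)
  apply/lee_addgt0Pr => eps e0; have [ws hws] := M_tight e0.
  pose n := (\max_(z <- ws) pickle z).+1.
  have ws_n : {subset ws <= zs n}.
    move=> z zws; rewrite mem_pmap; apply/mapP; exists (pickle z).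
      by rewrite mem_iota add0n /= ltnS; apply: leq_bigmax_seq.
    by rewrite pickleK_inv.
  have : ((1 - eps)%:E <= mseries mu_ 0 setT)%E.
    apply: le_trans (nneseries_lim_ge n _) => //; rewrite partial // lee_fin.
    have fq := @ulim_lin R U ultraU _ (zs n) (fun=> 1)
      (fun z m => M m (setT `&` slice z)) (fun z => Mq01 z setT measurableT).
    rewrite (eq_bigr _ (fun z _ => esym (mul1r _))) -(cvg_lim _ fq) //.
    apply: limr_ge; first by apply/cvg_ex; eexists; exact: fq.
    apply: oo_U; apply: filterS hws => m; move/le_trans; apply.
    rewrite (eq_bigr _ (fun z _ => mul1r _)) (rcontent_fibers (Mc m)) // setTI.
    by apply: (le_rcontent (Mc m)) => // w; exact: ws_n.
  by rewrite EFinB leeBlDr.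
pose Q : probability joint R :=
  HB.pack (mseries mu_ 0) (Measure_isProbability.Build _ _ _ (mseries mu_ 0) Q_setT).
exists Q; split=> [|f K f0 h]; first exact: Q_le.
have mf : measurable_fun setT (fun w : joint => f w.2).
  apply: (measurableT_comp (f := f)); last exact: measurable_snd.
  exact: measurable_lattice_fun.
rewrite ge0_integral_measure_series //; first last.
- exact/measurable_EFinP.
- by move=> w _; rewrite lee_fin.
have int_mu k : (\int[mu_ k]_w (f w.2)%:E =
    if pickle_inv k is Some z then (f z * q z setT)%:E else 0)%E.
  rewrite /mu_; case: pickle_inv => [z|]; last by rewrite integral_measure_zero.
  rewrite (ae_eq_integral (cst (f z)%:E)) //; first last.
  - exists (~` slice z); split; first exact: measurableC.
      rewrite nuE; last exact: measurableC.
      rewrite /q (_ : (fun m => _) = (fun=> 0)); first by rewrite /ulim lim_cst.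
      by apply/funext => m; rewrite setICl (rcontent0 (Mc m)).
    by move=> w /= nw wz; apply: nw => _; rewrite wz.
  - exact/measurable_EFinP.
  - by rewrite integral_cst // nuE // -EFinM.
apply: mseries_le => [k|n].
  rewrite int_mu; case: pickle_inv => // z.
  by rewrite lee_fin mulr_ge0 // (rcontent_ge0 (qc z)).
have -> : (\sum_(0 <= k < n) \int[mu_ k]_w (f w.2)%:E =
    (\sum_(z <- zs n) f z * q z setT)%:E)%E.
  rewrite -sumEFin big_pmap /index_iota subn0; apply: eq_bigr => k _.
  by rewrite int_mu; case: pickle_inv.
rewrite lee_fin; apply: q_le => // m.
rewrite (eq_bigr (fun z => f z * M m (slice z))) => [|z _]; last by rewrite setTI.
exact: h.
Qed.

End LimitCoupling.

(** * Random configurations under the product measure *)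

Section Configurations.
Variable d : nat.
Local Notation config := (config d).
Local Notation lattice := (lattice d).

Definition rectangle (s : seq lattice) (B : lattice -> set bool) : set config :=
  [set g | forall x, x \in s -> B x (g x)].

Lemma measurable_coordinate (x : lattice) (B : set bool) :
  measurable ([set g | B (g x)] : set config).
Proof.
apply: sub_gen_smallest; exists x => //; exists B => //.
by rewrite setTI.
Qed.

Lemma rectangle_cons x s B :
  rectangle (x :: s) B = [set g | B x (g x)] `&` rectangle s B.
Proof.
apply/seteqP; split=> g /=.
  by move=> h; split=> [|y ys]; apply: h; rewrite in_cons ?eqxx // ys orbT.
by move=> [gx h] y; rewrite in_cons => /orP[/eqP -> //|]; apply: h.
Qed.

Lemma measurable_rectangle s B : measurable (rectangle s B).
Proof.
elim: s => [|x s IH]; last first.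
  by rewrite rectangle_cons; apply: measurableI => //; exact: measurable_coordinate.
by rewrite (_ : rectangle _ _ = setT) //; apply/seteqP; split.
Qed.

Lemma measurable_shiftN (z : lattice) :
  measurable_fun setT (@shiftN d z : config -> config).
Proof.
apply: (@measurability _ _ config config setT (@shiftN d z)
  (@coordinate_events d)) => // _ [_ [x _ [B mB <-]] <-].
by rewrite !setTI; exact: (measurable_coordinate (x + z) B).
Qed.

(** These sets form a pi-system on which the product measure is prescribed. *)
Definition rectangles : set (set config) :=
  [set A | exists s B, uniq s /\ A = rectangle s B].

Lemma rectangles_generate : @measurable _ config = <<s rectangles >>.
Proof.
apply/seteqP; split.
  apply: smallest_sub; first exact: smallest_sigma_algebra.
  move=> _ [x _ [B mB <-]]; apply: sub_gen_smallest.
  exists [:: x], (fun=> B); split=> //; rewrite setTI.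
  apply/seteqP; split=> g /=; first by move=> h y; rewrite inE => /eqP ->.
  by apply; rewrite mem_head.
apply: smallest_sub; first exact: sigma_algebra_measurable.
by move=> _ [s [B [_ ->]]]; exact: measurable_rectangle.
Qed.

Lemma rectangles_setI : setI_closed rectangles.
Proof.
move=> _ _ [s [B [us ->]]] [s' [B' [us' ->]]].
exists (undup (s ++ s')), (fun x =>
  [set b | (x \in s -> B x b) /\ (x \in s' -> B' x b)]); split.
  exact: undup_uniq.
apply/seteqP; split=> g /=.
  by move=> [h h'] x _; split=> xs; [exact: h|exact: h'].
move=> h; split=> x xs.
  by have [|+ _] := h x; [rewrite mem_undup mem_cat xs|apply].
by have [|_] := h x; [rewrite mem_undup mem_cat xs orbT|apply].
Qed.

Variables (R : realType) (p : R) (mu : probability config R).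
Hypothesis p01 : 0 < p < 1.
Hypothesis mup : is_product_measure p mu.

(** The shifted measure is again a product measure with the same marginals, so
it agrees with mu on rectangles. *)
Lemma shift_invariant (z : lattice) (A : set config) : measurable A ->
  mu (@shiftN d z @^-1` A) = mu A.
Proof.
move=> mA; have mz := measurable_shiftN z.
(* nu is the image of mu under the shift *)
have [nu nuE] := @dominated_content_measure _ _ _ _ _ mu (@shiftN d z)
  (fun A => fine (mu (@shiftN d z @^-1` A))) mz
  (rcontent_preimage mz (rcontent_probability mu)) (fun A _ => lexx _).
have mzA B : measurable B -> measurable (@shiftN d z @^-1` B).
  by move=> mB; rewrite -[_ @^-1` _]setTI; exact: mz.
transitivity (nu A).
  by rewrite nuE // fineK // fin_num_measure //; exact: mzA.
apply: (measure_unique rectangles (fun=> setT)) => //.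
- exact: rectangles_generate.
- exact: rectangles_setI.
- move=> _; exists [::], (fun=> setT); split=> //.
  by apply/seteqP; split=> [g _ x|]; rewrite ?in_nil.
- by apply/seteqP; split=> // g _; exists 0%N.
- move=> _ [s [B [us ->]]]; rewrite nuE; last exact: measurable_rectangle.
  rewrite fineK; last first.
    by rewrite fin_num_measure //; apply: mzA; exact: measurable_rectangle.
  rewrite [RHS]mup //.
  have -> : @shiftN d z @^-1` rectangle s B =
      rectangle [seq x + z | x <- s] (fun y => B (y - z)).
    apply/seteqP; split=> g /=.
      by move=> h _ /mapP[x xs ->]; rewrite addrK; exact: h.
    by move=> h x xs; have := h (x + z); rewrite addrK; apply; exact: map_f.
  rewrite mup ?map_inj_uniq //; last exact: addIr.
  by rewrite big_map; apply: eq_bigr => x _; rewrite addrK.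
- by move=> _; rewrite nuE // fineK ?fin_num_measure //; try exact: mzA;
    rewrite preimage_setT probability_setT ltry.
Qed.

Let p01' : 0 <= p <= 1. Proof. by case/andP: p01 => *; rewrite !ltW. Qed.

Lemma bernoulli1 b : bernoulli_prob p [set b] = (if b then p else 1 - p)%:E.
Proof.
rewrite bernoulli_probE // !diracE; case: b.
  by rewrite mem_set // memNset //= mule1 mule0 adde0.
by rewrite memNset // mem_set //= mule1 mule0 add0e.
Qed.

Lemma pattern_rectangle (S : finType) (pos : S -> lattice)
    (eta : {ffun S -> bool}) :
  [set g : config | [ffun s => g (pos s)] = eta] =
  rectangle [seq pos s | s <- index_enum S]
    (fun y => [set b | forall s, pos s = y -> b = eta s]).
Proof.
apply/seteqP; split=> g /=.
  by move=> <- _ /mapP[s _ ->] s' <-; rewrite ffunE.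
move=> h; apply/ffunP => s; rewrite ffunE.
by apply: (h (pos s)) => //; rewrite map_f // mem_index_enum.
Qed.

Lemma measurable_pattern (S : finType) (pos : S -> lattice)
    (eta : {ffun S -> bool}) :
  measurable ([set g | [ffun s => g (pos s)] = eta] : set config).
Proof. by rewrite pattern_rectangle; exact: measurable_rectangle. Qed.

Lemma pattern_law (S : finType) (pos : S -> lattice)
    (eta : {ffun S -> bool}) :
  injective pos ->
  mu [set g | [ffun s => g (pos s)] = eta] = (weight p eta)%:E.
Proof.
move=> pos_inj; rewrite pattern_rectangle.
rewrite mup ?map_inj_uniq ?index_enum_uniq // big_map /weight -prodEFin.
apply: eq_bigr => s _; rewrite -bernoulli1; congr bernoulli_prob.
apply/seteqP; split=> b /=; first by apply.
by move=> -> s' /pos_inj ->.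
Qed.

Lemma occupied_law : mu (@occupied_origin d) = p%:E.
Proof.
have -> : @occupied_origin d = rectangle [:: 0] (fun=> [set true]).
  apply/seteqP; split=> g /=; first by move=> h x; rewrite inE => /eqP ->.
  by apply; rewrite mem_head.
by rewrite mup // big_seq1 bernoulli1.
Qed.

Lemma measurable_occupied : measurable (@occupied_origin d).
Proof. exact: (measurable_coordinate 0 [set true]). Qed.

Lemma mustarE A : measurable A ->
  mustar mu A = (fine (mu (A `&` @occupied_origin d)) / p)%:E.
Proof.
move=> mA; rewrite /mustar occupied_law /= EFinM fineK // fin_num_measure //.
by apply: measurableI => //; exact: measurable_occupied.
Qed.

End Configurations.

(** * The joint law defined by a transport plan *)

Section PlanCoupling.
Variables (R : realType) (d : nat) (p : R).
Hypothesis p01 : 0 < p < 1.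
Variable mu : probability (config d) R.
Hypothesis mup : is_product_measure p mu.
Context (dO : measure_display) (Omega : measurableType dO).
Variables (P : probability Omega R) (Gamma : {RV P >-> config d}).
Hypothesis Gamma_law : has_law P Gamma mu.
Local Notation joint := (Omega * lattice d)%type.
Variable pl : transport_plan d p.
Local Notation S := (target pl).
Local Notation X := (source pl).
Implicit Types (x : X) (s : S) (eta : {ffun S -> bool}) (B : set joint).

Let p0 : 0 < p. Proof. by case/andP: p01. Qed.

Definition shift_of x s : lattice d := target_pos pl s - source_pos pl x.

(** The occupation of the targets as seen from the source x, which is placed
at the origin. *)
Definition pattern x (g : config d) : {ffun S -> bool} :=
  [ffun s => g (shift_of x s)].

Definition pattern_event x eta : set Omega := (pattern x \o Gamma) @^-1` [set eta].

(** The joint law of the outcome and of X when x is a uniform source, and,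
given the pattern seen from x, the target s is chosen with probability flow
pl eta x s. *)
Definition plan_content B : R := #|S|%:R^-1 * \sum_x \sum_s \sum_eta
  flow pl eta x s *
  fine (P ((fun w => (w, shift_of x s)) @^-1` B `&` pattern_event x eta)).

Let mGamma A : measurable A -> measurable (Gamma @^-1` A).
Proof. by move=> mA; rewrite -[_ @^-1` _]setTI; exact: measurable_funPT. Qed.

Lemma measurable_pattern_event x eta : measurable (pattern_event x eta).
Proof. exact: (mGamma (measurable_pattern (shift_of x) eta)). Qed.

Lemma plan_content_real : real_content plan_content.
Proof.
apply: rcontentZ; first by rewrite invr_ge0.
apply: rcontent_sum => x; apply: rcontent_sum => s; apply: rcontent_sum => eta.
apply: rcontentZ; first exact: flow_ge0.
apply: (@rcontent_preimage _ _ _ _ R (fun w => (w, shift_of x s))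
  (fun A => fine (P (A `&` pattern_event x eta)))).
  exact: measurable_fun_pair.
apply: rcontent_restrict (rcontent_probability P).
exact: measurable_pattern_event.
Qed.

Let S0 : 0 < #|S|%:R :> R. Proof. by rewrite ltr0n card_target_gt0. Qed.

Let fineP_ge0 (A : set Omega) : 0 <= fine (P A).
Proof. exact/fine_ge0/measure_ge0. Qed.

Let sum_pattern x A : measurable A ->
  \sum_eta fine (P (A `&` pattern_event x eta)) = fine (P A).
Proof.
move=> mA; apply: (rcontent_partition (rcontent_probability P)) => // eta.
exact: measurable_pattern_event.
Qed.

(** A source sends out mass at most 1. *)
Lemma plan_content_fst A : measurable A -> plan_content (fst @^-1` A) <= fine (P A).
Proof.
move=> mA; rewrite /plan_content mulrC ler_pdivrMr // mulr_natr -(card_source pl).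
rewrite -sumr_const; apply: ler_sum => x _; rewrite exchange_big /= -(sum_pattern x mA).
apply: ler_sum => eta _.
have := ler_wpM2r (fineP_ge0 (A `&` pattern_event x eta)) (flow_out eta x).
by rewrite mul1r mulr_suml.
Qed.

Lemma plan_content_snd (D : set (lattice d)) :
  plan_content (snd @^-1` D) = #|S|%:R^-1 * \sum_eta weight p eta *
    \sum_x \sum_s if `[< D (shift_of x s) >] then flow pl eta x s else 0.
Proof.
have W x eta : fine (P (pattern_event x eta)) = weight p eta.
  have := Gamma_law (measurable_pattern (shift_of x) eta).
  rewrite /pushforward /pattern_event => ->; rewrite (pattern_law p01 mup) //.
  by move=> s s' /addIr /target_pos_inj.
congr (_ * _); under [RHS]eq_bigr do rewrite mulr_sumr.
rewrite [RHS]exchange_big; apply: eq_bigr => x _ /=.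
under [RHS]eq_bigr do rewrite mulr_sumr.
rewrite [RHS]exchange_big; apply: eq_bigr => s _ /=; apply: eq_bigr => eta _.
rewrite mulrC; case: asboolP => Dz.
  by rewrite -(W x eta); congr (fine (P _) * _); apply/seteqP; split=> w //= [].
rewrite mulr0 (_ : _ `&` _ = set0) ?measure0 ?mul0r //.
by apply/seteqP; split=> // w [].
Qed.

Lemma plan_content_setT : plan_content setT = plan_mass pl / #|S|%:R.
Proof.
rewrite -[setT](preimage_setT snd) plan_content_snd mulrC; congr (_ / _).
apply: eq_bigr => eta _; congr (_ * _); apply: eq_bigr => x _.
by apply: eq_bigr => s _; rewrite asboolT.
Qed.

Lemma plan_content_markov C c (D : set (lattice d)) :
  (forall z, D z -> c <= expR (C * enorm R z ^+ d)) ->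
  c * plan_content (snd @^-1` D) <= plan_cost C pl / #|S|%:R.
Proof.
move=> hD; rewrite plan_content_snd mulrCA mulrC ler_wpM2r ?invr_ge0 //.
rewrite mulr_sumr; apply: ler_sum => eta _; rewrite mulrCA ler_wpM2l ?weight_ge0 //.
rewrite mulr_sumr; apply: ler_sum => x _; rewrite mulr_sumr; apply: ler_sum => s _.
case: asboolP => Dz; last by rewrite mulr0 mulr_ge0 ?expR_ge0 // flow_ge0.
by rewrite mulrC ler_wpM2l ?flow_ge0 // hD.
Qed.

Lemma sum_exchange (I J K L : Type) (r : seq I) (rJ : seq J) (rK : seq K)
    (rL : seq L) (a : I -> R) (c : R) (w : J -> R) (G : I -> J -> K -> L -> R) :
  \sum_(z <- r) a z * (c * \sum_(j <- rJ) w j *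
      \sum_(k <- rK) \sum_(l <- rL) G z j k l) =
  c * \sum_(j <- rJ) w j *
      \sum_(k <- rK) \sum_(l <- rL) \sum_(z <- r) a z * G z j k l.
Proof.
under [LHS]eq_bigr do rewrite mulrCA; rewrite -mulr_sumr; congr (_ * _).
under [LHS]eq_bigr do rewrite mulr_sumr; rewrite exchange_big /=.
apply: eq_bigr => j _; under [LHS]eq_bigr do rewrite mulrCA.
rewrite -mulr_sumr; congr (_ * _).
under [LHS]eq_bigr do rewrite mulr_sumr; rewrite exchange_big /=.
apply: eq_bigr => k _.
by under [LHS]eq_bigr do rewrite mulr_sumr; rewrite exchange_big.
Qed.

Lemma plan_content_cost C (zs : seq (lattice d)) : uniq zs ->
  \sum_(z <- zs) expR (C * enorm R z ^+ d) * plan_content (snd @^-1` [set z])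
    <= plan_cost C pl / #|S|%:R.
Proof.
move=> uzs; under eq_bigr do rewrite plan_content_snd.
rewrite sum_exchange mulrC ler_wpM2r ?invr_ge0 //.
apply: ler_sum => eta _; rewrite ler_wpM2l ?weight_ge0 //.
apply: ler_sum => x _; apply: ler_sum => s _.
rewrite (eq_bigr (fun z => if z == shift_of x s then
    flow pl eta x s * expR (C * enorm R (shift_of x s) ^+ d) else 0)); last first.
  move=> z _; case: asboolP => [/= ->|/= /eqP zn]; first by rewrite eqxx mulrC.
  by rewrite eq_sym (negbTE zn) mulr0.
have F0 : 0 <= flow pl eta x s * expR (C * enorm R (shift_of x s) ^+ d).
  by rewrite mulr_ge0 ?expR_ge0 // flow_ge0.
have [zin|zout] := boolP (shift_of x s \in zs).
  by rewrite (bigD1_seq _ zin uzs) /= eqxx big1 ?addr0 // => z /negbTE ->.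
rewrite big1_seq // => z /andP[_ zz]; case: eqP => // E.
by rewrite E (negbTE zout) in zz.
Qed.

(** If the origin is at x and s is chosen, the shifted configuration has
the origin at s. By shift invariance, the sum over the sources x for fixed
s is the total mass received by s, which is at most 1/p and vanishes unless
s is a head. *)
Lemma plan_content_shift A : measurable A ->
  plan_content [set w | A (shiftN w.2 (Gamma w.1))] <= fine (mustar mu A).
Proof.
move=> mA; rewrite (mustarE p01 mup) //=.
have mO := @measurable_occupied d.
(* the pattern of the targets once the origin has been moved to s *)
pose tpat s (g : config d) : {ffun S -> bool} :=
  [ffun t => g (target_pos pl t - target_pos pl s)].
pose Occ := @occupied_origin d.
have mt s eta : measurable (tpat s @^-1` [set eta]).
  exact: (measurable_pattern (fun t => target_pos pl t - target_pos pl s) eta).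
have E x s eta : fine (P ((fun w => (w, shift_of x s)) @^-1`
      [set w | A (shiftN w.2 (Gamma w.1))] `&` pattern_event x eta)) =
    fine (mu (A `&` tpat s @^-1` [set eta])).
  rewrite -(shift_invariant mup (shift_of x s)); last exact: measurableI.
  have mB : measurable
      (@shiftN d (shift_of x s) @^-1` (A `&` tpat s @^-1` [set eta])).
    rewrite -[_ @^-1` _]setTI; apply: measurable_shiftN => //; exact: measurableI.
  rewrite -(Gamma_law mB) /pushforward; congr (fine (P _)).
  apply/seteqP; split=> w /= [Aw pw]; split=> //; move: pw => <-; apply/ffunP => t;
    by rewrite !ffunE /shiftN /shift_of addrA subrK.
rewrite /plan_content mulrC ler_pdivrMr // mulr_natr -sumr_const exchange_big /=.
apply: ler_sum => s _; rewrite exchange_big /=.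
have muc := rcontent_probability mu.
have mAO : measurable (A `&` Occ) by exact: measurableI.
rewrite ler_pdivlMr // -(rcontent_partition muc (mt s) mAO) mulr_suml.
apply: ler_sum => eta _.
under eq_bigr do rewrite E.
rewrite -mulr_suml mulrAC.
have := flow_in eta s; case es: (eta s); last first.
  rewrite mul0r => h; have -> : \sum_x flow pl eta x s = 0.
    by apply/le_anti; rewrite h sumr_ge0 // => x _; exact: flow_ge0.
  by rewrite !mul0r; exact/fine_ge0/measure_ge0.
rewrite ler_pdivlMr // => h.
(* the target s is a head of the pattern and sits at the origin *)
have -> : A `&` Occ `&` tpat s @^-1` [set eta] = A `&` tpat s @^-1` [set eta].
  apply/seteqP; split=> g /=; first by case=> -[].
  move=> [Ag tg]; split=> //; split=> //; rewrite /Occ /occupied_origin /=.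
  by move/ffunP/(_ s): tg; rewrite es ffunE subrr.
by rewrite -[leRHS]mul1r ler_wpM2r //; exact/fine_ge0/measure_ge0.
Qed.

End PlanCoupling.

(** * Extra head schemes *)

Lemma lattice_ball_finite (R : realType) (d r : nat) :
  exists zs : seq (lattice d), forall z, z \notin zs -> r%:R <= enorm R z.
Proof.
pose dec (f : {ffun 'I_d -> 'I_(r.*2.+1)}) : lattice d :=
  \row_i ((f i)%:Z - r%:Z).
exists [seq dec f | f <- index_enum {ffun 'I_d -> 'I_(r.*2.+1)}] => z.
apply: contraR; rewrite -ltNge => zr; apply/mapP.
have zi i : (`|z ord0 i| < r)%N.
  rewrite -(ltr_nat R); apply: le_lt_trans zr.
  rewrite -[leLHS]ger0_norm // -sqrtr_sqr ler_wsqrtr // (bigD1 i) //=.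
  rewrite -[leLHS]addr0 lerD //; last by apply: sumr_ge0 => j _; rewrite sqr_ge0.
  by rewrite -[leRHS]real_normK ?num_real // -intr_norm -abszE.
exists [ffun i => inord (absz (z ord0 i + r%:Z))]; first exact: mem_index_enum.
apply/rowP => i; rewrite !mxE ffunE inordK; move: (zi i); rewrite (ord1 ord0);
  move: (z _ i : int) => y; lia.
Qed.

(** Balls of the lattice are finite. *)
Lemma exp_enorm_coercive (R : realType) (d : nat) (C c : R) :
  (0 < d)%N -> 0 < C ->
  exists zs : seq (lattice d),
    forall z, z \notin zs -> c <= expR (C * enorm R z ^+ d).
Proof.
move=> d0 C0; pose r := (Num.bound (`|c| / C)).+1.
have [zs hzs] := lattice_ball_finite R d r; exists zs => z /hzs rz.
have r1 : 1 <= enorm R z by apply: le_trans rz; rewrite ler1n.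
apply: le_trans (expR_ge1Dx _).
have hc : `|c| / C <= enorm R z.
  apply: le_trans rz; rewrite ltW // (lt_trans (archi_boundP _)) ?ltr_nat //.
  by rewrite divr_ge0 // ltW.
have hd : enorm R z <= enorm R z ^+ d by rewrite ler_eXnr.
have : C * (`|c| / C) <= C * enorm R z ^+ d by rewrite ler_pM2l // (le_trans hc).
rewrite mulrC divfK ?gt_eqF // => h.
by apply: le_trans (ler_norm c) _; rewrite (le_trans h) // lerDr.
Qed.

(** Apply the inequality to a set and to its complement. *)
Lemma law_of_le (d1 d2 : measure_display) (T1 : measurableType d1)
    (T2 : measurableType d2) (R : realType) (Q : probability T1 R)
    (Y : T1 -> T2) (f : set T2 -> R) :
  measurable_fun setT Y -> (forall A, measurable A -> f A + f (~` A) = 1) ->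
  (forall A, measurable A -> (Q (Y @^-1` A) <= (f A)%:E)%E) ->
  forall A, measurable A -> Q (Y @^-1` A) = (f A)%:E.
Proof.
move=> mY f1 Qf A mA; apply/eqP; rewrite eq_le Qf //=.
have mYA : measurable (Y @^-1` A) by rewrite -[_ @^-1` _]setTI; exact: mY.
have := Qf _ (measurableC mA); rewrite preimage_setC probability_setC //.
rewrite -(fineK (fin_num_measure Q _ mYA)) -EFinB !lee_fin.
by have := f1 _ mA; lra.
Qed.

(** The lattice is countable, so it suffices to fix the value of the shift. *)
Lemma measurable_shifted (d : nat) (dO : measure_display)
    (Omega : measurableType dO) (Gamma : Omega -> config d) :
  measurable_fun setT Gamma ->
  measurable_fun setT (fun w : Omega * lattice d => shiftN w.2 (Gamma w.1)).
Proof.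
move=> mG _ A mA; rewrite setTI.
have -> : (fun w : Omega * lattice d => shiftN w.2 (Gamma w.1)) @^-1` A =
    \bigcup_z (fst @^-1` ((@shiftN d z \o Gamma) @^-1` A) `&` snd @^-1` [set z]).
  apply/seteqP; split=> [[w z] /= Aw|[w z] /= [z' _ [/= Aw ->]]] //.
  by exists z.
apply: countable_bigcupT_measurable; first exact: countableP.
move=> z; apply: measurableI.
  rewrite -[X in measurable X]setTI; apply: measurable_fst => //.
  rewrite -[X in measurable X]setTI.
  by apply: (measurableT_comp (measurable_shiftN z) mG).
by rewrite -[X in measurable X]setTI; exact: measurable_snd.
Qed.

Theorem theorem5 (R : realType) (d : nat) (p : R) :
  0 < p < 1 -> (3 <= d)%N ->
  exists C : R, 0 < C /\
    forall (mu : probability (config d) R), is_product_measure p mu ->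
    forall (dO : measure_display) (Omega : measurableType dO)
      (P : probability Omega R) (Gamma : {RV P >-> config d}),
      has_law P Gamma mu ->
    exists (dO' : measure_display) (Omega' : measurableType dO')
      (P' : probability Omega' R) (phi : {RV P' >-> Omega})
      (X : {RV P' >-> lattice d}),
      extra_head_scheme mu Gamma phi X /\
      ('E_P'[(fun w => expR (C * enorm R (X w) ^+ d))] < +oo)%E.
Proof.
move=> p01 d3; have /andP[p0 p1] := p01.
have d0 : (0 < d)%N by exact: leq_trans d3.
have [C [K [C0 plans]]] := transport_plans_exist p01 d3.
exists C; split=> // mu mup dO Omega P Gamma GL.
have inv0 m : 0 < m.+1%:R^-1 :> R by rewrite invr_gt0 ltr0n.
have [pl hpl] := choice (fun m => plans _ (inv0 m)).
pose M m := plan_content Gamma (pl m).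
have Mc m : real_content (M m) by exact: plan_content_real.
have M_fst m A : measurable A -> M m (fst @^-1` A) <= fine (P A).
  exact: plan_content_fst.
have T0 m : 0 < #|target (pl m)|%:R :> R by rewrite ltr0n card_target_gt0.
have M_cost m zs : uniq zs ->
    \sum_(z <- zs) expR (C * enorm R z ^+ d) * M m (snd @^-1` [set z]) <= K.
  move=> uzs; apply: (le_trans (plan_content_cost p01 mup GL (pl m) C uzs)).
  by rewrite ler_pdivrMr //; case: (hpl m).
have M_tight eps : 0 < eps -> exists zs : seq (lattice d),
    \forall m \near \oo, 1 - eps <= M m (snd @^-1` [set` zs]).
  (* chosen so that K / c <= eps / 2 in the exponential Markov inequality *)
  move=> e0; pose c := 2 * (`|K| + 1) / eps.
  have K1 : 0 < `|K| + 1 by rewrite ltr_wpDl.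
  have c0 : 0 < c by rewrite divr_gt0 // mulr_gt0.
  have [zs hzs] := exp_enorm_coercive c d0 C0; exists zs.
  have e2 : 0 < eps / 2 by rewrite divr_gt0.
  near=> m.
  have mzs : measurable (snd @^-1` [set` zs] : set (Omega * lattice d)).
    by rewrite -[X in measurable X]setTI; exact: measurable_snd.
  have out : M m (snd @^-1` (~` [set` zs])) <= eps / 2.
    have : c * M m (snd @^-1` (~` [set` zs])) <= K.
      apply: (le_trans (plan_content_markov p01 mup GL _ (C := C) _)).
        by move=> z /= /negP; exact: hzs.
      by rewrite ler_pdivrMr //; case: (hpl m).
    rewrite mulrC -ler_pdivlMr // => /le_trans; apply.
    rewrite ler_pdivrMr // /c.
    have -> : eps / 2 * (2 * (`|K| + 1) / eps) = `|K| + 1.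
      by field; rewrite gt_eqF.
    by apply: le_trans (ler_norm K) _; rewrite lerDl.
  have mass : 1 - eps / 2 <= M m setT.
    apply: (@le_trans _ _ (1 - m.+1%:R^-1)).
      rewrite lerD2l lerN2 ltW //; near: m.
      exact: near_infty_natSinv_lt (PosNum e2).
    rewrite /M (plan_content_setT p01 mup GL) ler_pdivlMr //.
    by case: (hpl m).
  have := rcontentD (Mc m) measurableT mzs (@subsetT _ _).
  by rewrite setTD => E; move: out mass; rewrite preimage_setC E; lra.
have [Q [Q_le Q_int]] := limit_coupling Mc M_fst M_tight.
pose phi0 : Omega * lattice d -> Omega := fst.
pose X0 : Omega * lattice d -> lattice d := snd.
pose phi : {RV Q >-> Omega} :=
  HB.pack phi0 (@isMeasurableFun.Build _ _ _ _ phi0 measurable_fst).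
pose X : {RV Q >-> lattice d} :=
  HB.pack X0 (@isMeasurableFun.Build _ _ _ _ X0 measurable_snd).
exists _, (Omega * lattice d)%type, Q, phi, X; split; last first.
  rewrite unlock; apply: le_lt_trans (ltry K).
  apply: (Q_int (fun z => expR (C * enorm R z ^+ d))) => [z|m zs].
    exact: expR_ge0.
  exact: M_cost.
split=> A mA; rewrite /pushforward.
  rewrite -[RHS]fineK ?fin_num_measure //.
  apply: (law_of_le (f := fun B => fine (P B))) mA => [|B mB|B mB].
  - exact: measurable_fst.
  - by rewrite probability_setC // fineB ?fin_num_measure //= addrC subrK.
  - apply: Q_le; last by move=> m; exact: M_fst.
    by rewrite -[X in measurable X]setTI; exact: measurable_fst.
have mY := measurable_shifted (measurable_funPT Gamma).
rewrite (mustarE p01 mup) //; have mO := @measurable_occupied d.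
apply: (law_of_le (f := fun B => fine (mu (B `&` @occupied_origin d)) / p)) mA => //.
  move=> B mB; rewrite -mulrDl -(rcontentU (rcontent_probability mu)).
  - by rewrite -setIUl setUv setTI (occupied_law p01 mup) mulfV // gt_eqF.
  - exact: measurableI.
  - by apply: measurableI => //; exact: measurableC.
  - by rewrite setIACA setICr set0I.
move=> B mB; apply: Q_le; first by rewrite -[X in measurable X]setTI; exact: mY.
move=> m; have := plan_content_shift p01 mup GL (pl m) mB.
by rewrite (mustarE p01 mup).
Unshelve. all: by end_near.
Qed.
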